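(* Let $n\ge 3$ and work in the formal, real analytic or holomorphic category. Let $f\in\mathcal F(\mathbb K^n)$ be a quasihomogeneous polynomial with $f(0)=0$ and of finite codimension. Then the space $H^1_f(\mathbb K^n)$ is of dimension $1$ over $\mathbb K$ and is spanned by (the class of) $df$.
   Context: $\mathbb K=\mathbb R$ or $\mathbb C$. $\mathcal F(\mathbb K^n)$ and $\Omega^k(\mathbb K^n)$ denote the spaces of germs at $0$ of functions and $k$-forms in the chosen category (formal power series, and forms with such coefficients, in the formal case). $f$ is of finite codimension if $Q_f=\mathcal F(\mathbb K^n)/I_f$ is finite dimensional, $I_f$ being the ideal generated by the partial derivatives of $f$. $f$ is quasihomogeneous of degree $\mathrm N$ if there are positive integers $w_1,\dots,w_n$ such that $W.f=\mathrm N f$ with $W=\sum_iw_ix_i\frac{\partial}{\partial x_i}$. $d_f:\Omega^k(\mathbb K^n)\to\Omega^{k+1}(\mathbb K^n)$ is $d_f\alpha=f\,d\alpha-k\,df\wedge\alpha$, which satisfies $d_f\circ d_f=0$, and $H^k_f(\mathbb K^n)$ is the $k$-th cohomology space of $(\Omega^\bullet(\mathbb K^n),d_f)$. *)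

(* Defs.v *)
From HB Require Import structures.
From mathcomp Require Import all_boot all_order all_algebra.
From mathcomp Require Import finmap.
From mathcomp Require Import boolp classical_sets functions reals.
From mathcomp Require Import topology normedtype derive summability.
(* the notations of [mpoly] clash with those of mathcomp-analysis *)
From mathcomp Require Import -(notations) mpoly.
From mathcomp Require Import -(notations) complex.

Set Implicit Arguments.
Unset Strict Implicit.
Unset Printing Implicit Defensive.

Import Order.TTheory GRing.Theory Num.Theory.
Import numFieldNormedType.Exports.

Local Open Scope ring_scope.
Local Open Scope classical_set_scope.

Section SubquotientDimension.
Variables (K : fieldType) (V : lmodType K).
Implicit Types Z B : V -> Prop.

(* Meaningful for linear subspaces [Z] and [B] of [V]: the classes of the [e i]
   span the image of [Z] in [V / B], resp. are linearly independent there. *)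
Definition spans_mod Z B m (e : 'I_m -> V) : Prop :=
  (forall i, Z (e i)) /\
  (forall v, Z v -> exists c : 'I_m -> K, B (v - \sum_i c i *: e i)).

Definition free_mod B m (e : 'I_m -> V) : Prop :=
  forall c : 'I_m -> K, B (\sum_i c i *: e i) -> forall i, c i = 0.

Definition has_dim_mod Z B m : Prop :=
  exists e : 'I_m -> V, spans_mod Z B e /\ free_mod B e.

Definition finite_dim_mod Z B : Prop := exists m, has_dim_mod Z B m.

End SubquotientDimension.

(* A category of germs at the origin of K^n.  A germ is given by a
   representative satisfying [germ_mem], and two representatives define the
   same germ when they are related by [germ_eq]. *)
Record germs (K : numFieldType) (n : nat) := Germs {
  germ_rep :> lmodType K;
  germ_mem : germ_rep -> Prop;
  germ_eq : germ_rep -> germ_rep -> Prop;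
  germ_mul : germ_rep -> germ_rep -> germ_rep;
  germ_der : 'I_n -> germ_rep -> germ_rep;
  germ_poly : mpoly n K -> germ_rep }.

Section FormalGerms.
Variables (K : numFieldType) (n : nat).

Definition fps : lmodType K := multinom n -> K^o.

(* same shape as [mcoeffM] *)
Definition fps_mul (a b : fps) : fps := fun m =>
  \sum_(k : (bmultinom n (mdeg m).+1 * bmultinom n (mdeg m).+1)%type
        | m == mnm_add k.1 k.2) a k.1 * b k.2.

Definition fps_der (i : 'I_n) (a : fps) : fps := fun m =>
  a (mnm_add m (mnm1 i)) *+ (m i).+1.

Definition formal_germs : germs K n :=
  @Germs K n fps (fun _ => True) eq fps_mul fps_der
    (fun p m => mcoeff m p).

End FormalGerms.

Section AnalyticGerms.
Variables (K : numFieldType) (n : nat).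

Definition power_term (a : multinom n -> K) (x : 'rV[K]_n) : multinom n -> K :=
  fun m => a m * \prod_(i < n) x 0 i ^+ m i.

(* h is the sum of a power series near 0 (for K = C this defines holomorphic
   germs).  The convergence is unordered, hence absolute over R and C. *)
Definition analytic_at0 (h : 'rV[K]_n -> K) : Prop :=
  exists a : multinom n -> K, \forall x \near (0 : 'rV[K]_n),
    partial_sum (power_term a x) @ totally --> (h x : K).

Definition analytic_germs : germs K n :=
  @Germs K n ('rV[K]_n -> K^o) analytic_at0
    (fun g h => \forall x \near (0 : 'rV[K]_n), g x = h x)
    (fun g h x => g x * h x)
    (fun i h => 'D_(delta_mx 0 i) h)
    (fun p x => meval (fun i => x 0 i) p).

End AnalyticGerms.

Section Forms.
Variables (K : numFieldType) (n : nat) (F : germs K n).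

Definition kset k := {I : {set 'I_n} | #|I| == k}.

(* [alpha I] is the coefficient of dx_i1 /\ ... /\ dx_ik,
   where I = {i1 < ... < ik}. *)
Definition form k := {ffun kset k -> F}.

Definition is_form k (alpha : form k) : Prop :=
  forall I, germ_mem (alpha I).

Definition form_eq k (alpha beta : form k) : Prop :=
  forall I, germ_eq (alpha I) (beta I).

Definition form0 (a : F) : form 0 := [ffun => a].

Definition form_mul k (a : F) (alpha : form k) : form k :=
  [ffun I => germ_mul a (alpha I)].

Definition dx (i : 'I_n) : form 1 :=
  [ffun I => if val I == [set i]%SET then germ_poly F 1 else 0].

(* sign of the permutation that sorts J followed by L *)
Definition shuffle_sign (J L : {set 'I_n}) : K :=
  (-1) ^+ #|[set p : 'I_n * 'I_n | [&& p.1 \in J, p.2 \in L & (p.2 < p.1)%N]]%SET|.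

Definition wedge p q (alpha : form p) (beta : form q) : form (p + q) :=
  [ffun I : kset (p + q) =>
     \sum_(J : kset p)
       \sum_(L : kset q | [disjoint val J & val L] &&
                          (val J :|: val L == val I)%SET)
         shuffle_sign (val J) (val L) *: germ_mul (alpha J) (beta L)].

Definition ext_d k (alpha : form k) : form k.+1 :=
  \sum_(i < n) (wedge (dx i) [ffun I => germ_der i (alpha I)] : form (1 + k)).

Definition dfun (a : F) : form 1 := ext_d (form0 a).

Definition d_f (f : F) k (alpha : form k) : form k.+1 :=
  form_mul f (ext_d alpha) - k%:R *: (wedge (dfun f) alpha : form (1 + k)).

Definition cocycle (f : F) k (alpha : form k) : Prop :=
  is_form alpha /\ form_eq (d_f f alpha) 0.

Definition coboundary (f : F) k : form k -> Prop :=
  match k with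
  | 0 => fun alpha => form_eq alpha 0
  | k'.+1 => fun alpha =>
      exists beta : form k', is_form beta /\ form_eq alpha (d_f f beta)
  end.

Definition jacobian_ideal (f : F) (h : F) : Prop :=
  exists g : 'I_n -> F, (forall i, germ_mem (g i)) /\
    germ_eq h (\sum_i germ_mul (g i) (germ_der i f)).

Definition finite_codimension (f : F) : Prop :=
  finite_dim_mod (@germ_mem K n F) (jacobian_ideal f).

End Forms.

Definition quasihomogeneous (K : numFieldType) n (f : mpoly n K) : Prop :=
  exists (N : nat) (w : 'I_n -> nat),
    (forall i, (0 < w i)%N) /\
    \sum_(i < n) (w i)%:R *: (mpolyX K (mnm1 i) * mderiv i f)
      = N%:R *: f.

Inductive setting := FormalReal | FormalComplex | RealAnalytic | Holomorphic.

Definition ground (R : realType) (s : setting) : numFieldType :=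
  match s with
  | FormalReal | RealAnalytic => R
  | FormalComplex | Holomorphic => complex R
  end.

Definition germs_at0 (R : realType) (s : setting) n : germs (ground R s) n :=
  match s with
  | FormalReal | FormalComplex => formal_germs (ground R s) n
  | RealAnalytic | Holomorphic => analytic_germs (ground R s) n
  end.

(* Main.v *)
Require Import Defs.
From HB Require Import structures.
From mathcomp Require Import all_boot all_order all_algebra.
From mathcomp Require Import ring zify.
From mathcomp Require Import boolp functions reals.
From mathcomp Require Import -(notations) mpoly.
From mathcomp Require Import -(notations) complex.

(** Let [w] be the weights, [E] the Euler field, so that [E f = N f], and let [i_E] and
    [L_E] be contraction and Lie derivative along [E].

    Formal series.  Finite codimension puts a power of every variable in the Jacobian
    ideal ([finite_codimension_power], [ideal_weight_component]).  Elements of that ideal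
    act on the Koszul complex of the partial derivatives of [f] by maps homotopic to
    zero, and powers of three distinct variables form a regular sequence; hence the Koszul
    cohomology vanishes in degrees 0, 1 and 2 ([koszul0], [koszul1], [koszul2]).  In other
    words a 1-form or a 2-form annihilated by [df] is divisible by [df]; degree 2 is
    where three variables are required.

    Let [A] be a cocycle, [f dA = df /\ A].  Contracting with [E] gives
    [f (N A - i_E dA) = (i_E A) df].  Division yields [b] with [N A - i_E dA = b df] and
    [i_E A = f b], and Cartan's formula turns this into [(L_E - N) A = f db]
    ([closed1_divide]).  As [L_E] is diagonal on monomials, dividing the coefficients of
    [b] by their weights produces [g] with [(L_E - N) (f dg) = f db]; so [A - f dg] is a
    cocycle of pure weight [N] ([closed1_spanned]).  For a pure cocycle
    [df /\ dA = 0], so [dA = df /\ u] with [u] of weight 0.  Since the [dx_i] have positive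
    weight, [u], hence [dA], vanishes; then [df /\ A = 0], and [A] is a multiple of
    [df] by a function of weight 0, a constant ([closed1_pure]).  Finally [c df = f dg]
    contracts to [c N f = f E g], and [E g] has no constant term, so [c = 0]
    ([df_not_exact]).

    Convergent series.  A germ is determined by its Taylor series, compatibly with all
    the operations ([taylor_analytic]), so a convergent cocycle is [c df + f dg] with [g]
    formal, and [f dg] convergent.  Division by a polynomial preserves geometric bounds on
    coefficients ([bnd_div]), hence [dg] and [g] converge as well. *)

Set Implicit Arguments.
Unset Strict Implicit.
Unset Printing Implicit Defensive.
Import Order.TTheory GRing.Theory Num.Theory.
Local Open Scope ring_scope.

Local Notation "m1 ++m m2" := (mnm_add m1 m2) (at level 50, left associativity).

(** * The ring of formal power series *)

Section PowerSeries.
Variables (K : numFieldType) (n : nat).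
Local Notation mon := (multinom n).
Local Notation mp := (mpoly n K).

(** An alias, so that the convolution product does not compete with the pointwise
    product of functions. *)
Definition pser := mon -> K.
HB.instance Definition _ := GRing.Lmodule.copy pser (mon -> K^o).

Implicit Types a b c : pser.

Definition trunc d a : mp := \sum_(m : bmultinom n d) a m *: mpolyX K m.

Lemma mcoeff_trunc d a m : (mdeg m < d)%N -> mcoeff m (trunc d a) = a m.
Proof. exact: mcoeff_mpoly. Qed.

Definition pmul a b : pser := fps_mul a b.

Definition pser_poly (p : mp) : pser := fun m => mcoeff m p.

(** Convolution is local in the degree: a coefficient of a product can be read off any
    polynomials that agree with the factors up to that degree.  All the ring axioms, and
    the Leibniz rule, are inherited from polynomials in this way. *)
Lemma pmulE d a b m (p q : mp) : (mdeg m < d)%N ->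
    (forall k, (mdeg k < d)%N -> mcoeff k p = a k) ->
    (forall k, (mdeg k < d)%N -> mcoeff k q = b k) ->
  pmul a b m = mcoeff m (p * q).
Proof.
move=> md pa qb; rewrite mcoeffM /pmul /fps_mul; apply: eq_bigr => k _.
by rewrite pa ?qb //; apply: leq_trans md; apply: bmdeg.
Qed.

Lemma pmul_truncE d a b m : (mdeg m < d)%N ->
  pmul a b m = mcoeff m (trunc d a * trunc d b).
Proof. by move=> md; apply: (pmulE md) => k kd; rewrite mcoeff_trunc. Qed.

Let pmulA : associative pmul.
Proof.
move=> a b c; apply/funext => m; set d := (mdeg m).+1.
rewrite (pmulE (d := d) (p := trunc d a) (q := trunc d b * trunc d c)) //.
- rewrite mulrA; apply/esym/(pmulE (d := d)) => // k kd.
  + by rewrite -pmul_truncE.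
  + by rewrite mcoeff_trunc.
- by move=> k kd; rewrite mcoeff_trunc.
- by move=> k kd; rewrite -pmul_truncE.
Qed.

Let pmulC : commutative pmul.
Proof.
by move=> a b; apply/funext => m; rewrite !(pmul_truncE _ _ (ltnSn _)) mulrC.
Qed.

Let pmul1 : left_id (pser_poly 1) pmul.
Proof.
move=> a; apply/funext => m.
rewrite (pmulE (d := (mdeg m).+1) (p := 1) (q := trunc (mdeg m).+1 a)) //.
  by rewrite mul1r mcoeff_trunc.
by move=> k kd; rewrite mcoeff_trunc.
Qed.

Lemma trunc_is_linear d : linear (trunc d).
Proof.
move=> x a b; rewrite /trunc scaler_sumr -big_split /=; apply: eq_bigr => m _.
by rewrite scalerA -scalerDl.
Qed.
HB.instance Definition _ d := GRing.isLinear.Build K pser mp _ (trunc d) (trunc_is_linear d).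

Let pmulDl : left_distributive pmul +%R.
Proof.
move=> a b c; apply/funext => m; rewrite !fctE.
by rewrite !(pmul_truncE _ _ (ltnSn _)) linearD mulrDl linearD.
Qed.

Let pone_neq0 : pser_poly 1 != 0.
Proof.
apply/eqP => /(congr1 (fun a : pser => a mnm0)).
by rewrite /pser_poly mcoeff1 eqxx => /eqP; rewrite oner_eq0.
Qed.

HB.instance Definition _ := GRing.Zmodule_isComNzRing.Build pser pmulA pmulC pmul1 pmulDl pone_neq0.

Lemma pserM_polyE d a b m (p q : mp) : (mdeg m < d)%N ->
    (forall k, (mdeg k < d)%N -> mcoeff k p = a k) ->
    (forall k, (mdeg k < d)%N -> mcoeff k q = b k) ->
  (a * b) m = mcoeff m (p * q).
Proof. exact: pmulE. Qed.

Lemma pserM_truncE d a b m : (mdeg m < d)%N ->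
  (a * b) m = mcoeff m (trunc d a * trunc d b).
Proof. exact: pmul_truncE. Qed.

Lemma pserD a b m : (a + b) m = a m + b m. Proof. by []. Qed.
Lemma pserN a m : (- a) m = - a m. Proof. by []. Qed.
Lemma pserZ x a m : (x *: a) m = x * a m. Proof. by []. Qed.
Lemma pser0 m : (0 : pser) m = 0. Proof. by []. Qed.
Lemma pser_sum I (r : seq I) (P : pred I) (F : I -> pser) m :
  (\sum_(i <- r | P i) F i) m = \sum_(i <- r | P i) F i m.
Proof. by elim/big_rec2: _ => // i x y _ <-. Qed.
Lemma pserM a b m : (a * b) m =
  \sum_(k : (bmultinom n (mdeg m).+1 * bmultinom n (mdeg m).+1)%type
        | m == mnm_add k.1 k.2) a k.1 * b k.2.
Proof. by []. Qed.

Lemma pser1 m : (1 : pser) m = (m == mnm0)%:R.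
Proof. by rewrite -[1]/(pser_poly 1) /pser_poly mcoeff1. Qed.

Lemma pser_poly_is_linear : linear pser_poly.
Proof. by move=> x p q; apply/funext => m; rewrite /pser_poly linearP. Qed.
HB.instance Definition _ := GRing.isLinear.Build K mp pser _ pser_poly pser_poly_is_linear.
Lemma pser_polyM p q : pser_poly (p * q) = pser_poly p * pser_poly q.
Proof. by apply/funext => m; apply/esym/(pserM_polyE (ltnSn _)). Qed.
HB.instance Definition _ := GRing.isMonoidMorphism.Build mp pser pser_poly
  (erefl, pser_polyM).

Lemma pser_scaleAl x a b : x *: (a * b) = x *: a * b.
Proof.
apply/funext => m; rewrite pserZ !(pserM_truncE _ _ (ltnSn _)).
by rewrite linearZ /= -scalerAl mcoeffZ.
Qed.
HB.instance Definition _ := GRing.Lmodule_isLalgebra.Build K pser pser_scaleAl.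
HB.instance Definition _ := GRing.Lalgebra_isComAlgebra.Build K pser.

Definition pX (m : mon) : pser := pser_poly (mpolyX K m).

Lemma pserXM m k a : (pX m * a) (m ++m k) = a k.
Proof.
rewrite (pserM_polyE (d := (mdeg (m ++m k)).+1) (p := mpolyX K m) (q := trunc (mdeg (m ++m k)).+1 a)) //.
  by rewrite mulrC mcoeffMX mcoeff_trunc // ltnS mdegD leq_addl.
by move=> l ld; rewrite mcoeff_trunc.
Qed.

Lemma pserXM_out m k a : ~~ lem m k -> (pX m * a) k = 0.
Proof.
move=> mk; rewrite pserM big1 // => -[k1 k2] /= /eqP ek.
rewrite /pX /pser_poly mcoeffX; case: eqP => [em|_]; last by rewrite mul0r.
by case/negP: mk; rewrite ek em lem_addr.
Qed.

Definition pD i a : pser := fps_der i a.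

Lemma pDE i a m : pD i a m = a (m ++m mnm1 i) *+ (m i).+1.
Proof. by []. Qed.

Lemma pD_is_linear i : linear (pD i).
Proof.
by move=> x a b; apply/funext => m; rewrite !(pDE, pserD, pserZ) mulrnDl mulrnAr.
Qed.
HB.instance Definition _ i := GRing.isLinear.Build K pser pser _ (pD i) (pD_is_linear i).

Lemma pDM i a b : pD i (a * b) = pD i a * b + a * pD i b.
Proof.
apply/funext => m; rewrite pDE pserD; set d := (mdeg m).+2.
have dm : (mdeg (m ++m mnm1 i) < d)%N by rewrite mdegD mdeg1 addn1.
rewrite (pserM_truncE _ _ dm) -mcoeff_mderiv mderivM linearD /=.
have H (x : pser) k : (mdeg k < (mdeg m).+1)%N ->
    mcoeff k (mderiv i (trunc d x)) = pD i x k.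
  by move=> kd; rewrite mcoeff_mderiv mcoeff_trunc // mdegD mdeg1 addn1 ltnS.
have H' (x : pser) k : (mdeg k < (mdeg m).+1)%N -> mcoeff k (trunc d x) = x k.
  by move=> kd; rewrite mcoeff_trunc // ltnW // ltnS.
by congr (_ + _); apply/esym/(pserM_polyE (ltnSn _)) => k kd; rewrite ?H ?H'.
Qed.

Lemma pDC i j a : pD i (pD j a) = pD j (pD i a).
Proof.
apply/funext => m; rewrite !pDE !mnmDE !mnm1E -!mulrnA -!addmA (addmC (mnm1 j)).
by congr (_ *+ _); rewrite (eq_sym j i); case: eqP => [->|]; rewrite /= ?addn0 // mulnC.
Qed.

Lemma pD_poly i p : pD i (pser_poly p) = pser_poly (mderiv i p).
Proof. by apply/funext => m; rewrite /pser_poly mcoeff_mderiv. Qed.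

End PowerSeries.

(** * Koszul exactness in degrees 1 and 2 *)

Section Koszul.
Variables (R : comNzRingType) (n : nat) (F : 'I_n -> R).

Definition in_ideal (g : R) := exists h : 'I_n -> R, g = \sum_i h i * F i.

Variables g1 g2 g3 : R.
Hypotheses (Ig1 : in_ideal g1) (Ig2 : in_ideal g2) (Ig3 : in_ideal g3).
Hypothesis reg1 : GRing.lreg g1.
Hypothesis reg2 : forall u v, g2 * u = g1 * v -> exists u', u = g1 * u'.
Hypothesis reg3 : forall u v w, g3 * u = g1 * v + g2 * w ->
  exists v' w', u = g1 * v' + g2 * w'.

Lemma koszul0 u : (forall i, F i * u = 0) -> u = 0.
Proof.
case: Ig1 => h g1E Fu; apply: reg1; rewrite mulr0 g1E mulr_suml big1 // => i _.
by rewrite -mulrA Fu mulr0.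
Qed.

(** The homotopy is contraction with the vector field of coefficients of [g]. *)
Lemma ideal_kills1 g (om : 'I_n -> R) : in_ideal g ->
    (forall i j, F i * om j = F j * om i) ->
  exists u, forall i, g * om i = F i * u.
Proof.
move=> [h ->] sym; exists (\sum_j h j * om j) => i.
rewrite mulr_suml mulr_sumr; apply: eq_bigr => j _.
by rewrite -mulrA sym; ring.
Qed.

(** Both [g1 om] and [g2 om] are multiples of [F]; by regularity of the pair [g1, g2]
    the first quotient is divisible by [g1]. *)
Lemma koszul1 (om : 'I_n -> R) :
    (forall i j, F i * om j = F j * om i) -> exists u, forall i, om i = F i * u.
Proof.
move=> sym; have [u uE] := ideal_kills1 Ig1 sym; have [v vE] := ideal_kills1 Ig2 sym.
have /reg2 [u' u'E] : g2 * u = g1 * v.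
  apply/eqP; rewrite -subr_eq0; apply/eqP/koszul0 => i.
  by rewrite mulrBr !(mulrCA (F i)) -uE -vE; ring.
by exists u' => i; apply: reg1; rewrite uE u'E; ring.
Qed.

Lemma ideal_kills2 g (om : 'I_n -> 'I_n -> R) : in_ideal g ->
    (forall i j, om i j = - om j i) ->
    (forall i j k, F i * om j k + F j * om k i + F k * om i j = 0) ->
  exists u : 'I_n -> R, forall j k, g * om j k = F j * u k - F k * u j.
Proof.
move=> [h ->] anti clo; exists (fun k => \sum_i h i * om i k) => j k.
rewrite mulr_suml !mulr_sumr -sumrB; apply: eq_bigr => i _.
have /(congr1 (fun x => h i * x)) := clo i j k.
rewrite (anti k i) mulr0 => /eqP; rewrite -subr_eq0 => /eqP H.
by apply/eqP; rewrite -subr_eq0 -H; apply/eqP; ring.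
Qed.

(** Same principle as in degree 1, one step further: the primitives of the multiples
    [g_i om] differ by closed 1-forms, hence by multiples of [F]; the three
    multipliers satisfy a linear relation, which the third regularity hypothesis
    uses to correct the primitive of [g1 om] into one divisible by [g1]. *)
Lemma koszul2 (om : 'I_n -> 'I_n -> R) :
    (forall i j, om i j = - om j i) ->
    (forall i j k, F i * om j k + F j * om k i + F k * om i j = 0) ->
  exists u : 'I_n -> R, forall j k, om j k = F j * u k - F k * u j.
Proof.
move=> anti clo.
have [u1 u1E] := ideal_kills2 Ig1 anti clo.
have [u2 u2E] := ideal_kills2 Ig2 anti clo.
have [u3 u3E] := ideal_kills2 Ig3 anti clo.
have cross g g' (u u' : 'I_n -> R) :
    (forall j k, g * om j k = F j * u k - F k * u j) ->
    (forall j k, g' * om j k = F j * u' k - F k * u' j) ->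
    exists v, forall i, g' * u i - g * u' i = F i * v.
  move=> uE u'E; apply: koszul1 => j k.
  have H := congr1 (fun x => g' * x) (uE j k).
  have H' := congr1 (fun x => g * x) (u'E j k).
  apply/eqP; rewrite -subr_eq0; apply/eqP.
  transitivity (g' * (F j * u k - F k * u j) - g * (F j * u' k - F k * u' j)); first by ring.
  by rewrite -H -H'; ring.
have [v12 v12E] := cross _ _ _ _ u1E u2E.
have [v13 v13E] := cross _ _ _ _ u1E u3E.
have [v23 v23E] := cross _ _ _ _ u2E u3E.
have /reg3 [a [b vE]] : g3 * v12 = g1 * (- v23) + g2 * v13.
  apply/eqP; rewrite -subr_eq0; apply/eqP/koszul0 => i.
  transitivity (g3 * (F i * v12) + g1 * (F i * v23) - g2 * (F i * v13)); first by ring.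
  by rewrite -v12E -v13E -v23E; ring.
have /choice [u uE] k : exists u', u1 k - F k * b = g1 * u'.
  apply: (reg2 (v := u2 k + F k * a)).
  have := v12E k; rewrite vE => /eqP; rewrite -subr_eq0 => /eqP H.
  by apply/eqP; rewrite -subr_eq0 -H; apply/eqP; ring.
exists u => j k; apply: reg1; rewrite u1E.
transitivity (F j * (u1 k - F k * b) - F k * (u1 j - F j * b)); first by ring.
by rewrite !uE; ring.
Qed.

End Koszul.

Section VariablePowers.
Variables (K : numFieldType) (n : nat).
Local Notation ps := (pser K n).
Local Notation mon := (multinom n).

Definition xpow (i : 'I_n) k : ps := pX K (mnm_muln (mnm1 i) k).

Lemma xpow_lem i k (m : mon) : lem (mnm_muln (mnm1 i) k) m = (k <= m i)%N.
Proof.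
apply/mnm_lepP/idP => [/(_ i)|km j]; first by rewrite mulmnE mnm1E eqxx mul1n.
by rewrite mulmnE mnm1E; case: eqP => [<-|]; rewrite ?mul1n ?mul0n.
Qed.

Lemma xpowM i k (a : ps) (m : mon) : (k <= m i)%N ->
  (xpow i k * a) m = a (mnm_sub m (mnm_muln (mnm1 i) k)).
Proof. by rewrite -xpow_lem => /submK {1}<-; rewrite addmC pserXM. Qed.

Lemma xpowM_out i k (a : ps) (m : mon) : (m i < k)%N -> (xpow i k * a) m = 0.
Proof. by rewrite ltnNge -xpow_lem; apply: pserXM_out. Qed.

Lemma xpowM_shift i k (a : ps) m : (xpow i k * a) (mnm_muln (mnm1 i) k ++m m) = a m.
Proof. exact: pserXM. Qed.

Lemma xpow_lreg i k : GRing.lreg (xpow i k).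
Proof.
move=> a b ab; apply/funext => m.
by rewrite -(xpowM_shift i k a) ab xpowM_shift.
Qed.

Lemma shift_other (i j : 'I_n) k (m : mon) : i != j -> (mnm_muln (mnm1 j) k ++m m) i = m i.
Proof. by move=> ij; rewrite mnmDE mulmnE mnm1E eq_sym (negbTE ij). Qed.

(** Membership in an ideal generated by powers of variables is tested monomial by
    monomial; this gives both regularity statements below. *)
Lemma xpow_split (i j : 'I_n) k l (u : ps) :
    (forall m : mon, (m i < k)%N -> (m j < l)%N -> u m = 0) ->
  exists v w, u = xpow i k * v + xpow j l * w.
Proof.
move=> u0; exists (fun m => u (mnm_muln (mnm1 i) k ++m m)).
pose w : ps := fun m => let m' := mnm_muln (mnm1 j) l ++m m in if (m' i < k)%N then u m' else 0.
exists w; apply/funext => m; rewrite pserD; case: (ltnP (m i) k) => mi.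
  rewrite xpowM_out // add0r; case: (ltnP (m j) l) => mj; first by rewrite xpowM_out ?u0.
  by rewrite xpowM // /w /= addmC submK ?xpow_lem // mi.
rewrite xpowM // addmC submK ?xpow_lem //; case: (ltnP (m j) l) => mj.
  by rewrite xpowM_out ?addr0.
by rewrite xpowM // /w /= addmC submK ?xpow_lem // ltnNge mi addr0.
Qed.

Lemma xpow_reg2 (i j : 'I_n) k l (u v : ps) : i != j ->
  xpow j l * u = xpow i k * v -> exists u', u = xpow i k * u'.
Proof.
move=> ij uv; suff [v' [w' ->]] : exists v w, u = xpow i k * v + xpow i k * w.
  by exists (v' + w'); rewrite mulrDr.
apply: xpow_split => m mi _; rewrite -(xpowM_shift j l u) uv xpowM_out //.
by rewrite shift_other.
Qed.

Lemma xpow_reg3 (i1 i2 i3 : 'I_n) k1 k2 k3 (u v w : ps) : i1 != i3 -> i2 != i3 ->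
    xpow i3 k3 * u = xpow i1 k1 * v + xpow i2 k2 * w ->
  exists v' w', u = xpow i1 k1 * v' + xpow i2 k2 * w'.
Proof.
move=> i13 i23 uvw; apply: xpow_split => m m1 m2.
by rewrite -(xpowM_shift i3 k3 u) uvw pserD !xpowM_out ?addr0 // shift_other.
Qed.

End VariablePowers.

(** * Weights, the Euler field and leading monomials *)

Section Weights.
Variables (K : numFieldType) (n : nat).
Local Notation ps := (pser K n).
Local Notation mon := (multinom n).
Implicit Types (w : 'I_n -> nat) (m k : mon) (a b : ps).

Definition wt w m : nat := (\sum_i w i * m i)%N.

Lemma wtD w m k : wt w (m ++m k) = (wt w m + wt w k)%N.
Proof. by rewrite -big_split; apply: eq_bigr => i _; rewrite mnmDE mulnDr. Qed.

Lemma wtMn w m (k : nat) : wt w (mnm_muln m k) = (wt w m * k)%N.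
Proof. by rewrite big_distrl /=; apply: eq_bigr => i _; rewrite mulmnE; ring. Qed.

Lemma wt1 w i : wt w (mnm1 i) = w i.
Proof.
rewrite /wt (bigD1 i) //= mnm1E eqxx muln1 big1 ?addn0 // => j ji.
by rewrite mnm1E eq_sym (negbTE ji) muln0.
Qed.

Lemma wt0 w : wt w mnm0 = 0%N.
Proof. by rewrite /wt big1 // => i _; rewrite mnm0E muln0. Qed.

Lemma wt_eq0 w m : (forall i, 0 < w i)%N -> wt w m = 0%N -> m = mnm0.
Proof.
move=> w0 /eqP; rewrite sum_nat_eq0 => /forallP H; apply/mnmP => i.
by have := H i; rewrite mnm0E muln_eq0 eqn0Ngt w0 => /eqP.
Qed.

Lemma mnm_neq0 m : m != mnm0 -> exists i, m i != 0%N.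
Proof.
move=> m0; apply: contrapT => /forallNP E; case/eqP: m0; apply/mnmP => i.
by have /negP := E i; rewrite negbK mnm0E => /eqP.
Qed.

Lemma pserM_eq (a a' b b' : ps) m :
  (forall k1 k2 : mon, m = k1 ++m k2 -> a k1 * b k2 = a' k1 * b' k2) ->
  (a * b) m = (a' * b') m.
Proof. by move=> H; apply: eq_bigr => -[k1 k2] /= /eqP /H. Qed.

Lemma pserM_eq0 a b m :
  (forall k1 k2 : mon, m = k1 ++m k2 -> a k1 * b k2 = 0) -> (a * b) m = 0.
Proof. by move=> H; rewrite (@pserM_eq a 0 b 0) ?mul0r // => k1 k2 /H ->; rewrite mul0r. Qed.

Lemma pXM k a m : (pX K k * a) m = if lem k m then a (mnm_sub m k) else 0.
Proof.
case: ifP => [/submK {1}<-|/negbT /pserXM_out -> //].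
by rewrite addmC pserXM.
Qed.

Definition px i : ps := pX K (mnm1 i).

Lemma px_pD i a m : (px i * pD i a) m = (m i)%:R * a m.
Proof.
rewrite pXM lep1mP; case: eqP => [->|/eqP mi /=]; first by rewrite mul0r.
have lm : lem (mnm1 i) m by rewrite lep1mP.
rewrite pDE submK // -[LHS]mulr_natl; congr (_ * _).
by rewrite mnmBE mnm1E eqxx subn1 prednK // lt0n.
Qed.

Lemma pD_px i j : pD i (px j) = (i == j)%:R.
Proof.
rewrite /px /pX pD_poly mderivX mnm1E eq_sym; case: eqP => [->|_]; last by rewrite scale0r raddf0.
rewrite scale1r; have -> : mnm_sub (mnm1 j) (mnm1 j) = mnm0.
  by apply/mnmP => l; rewrite mnmBE mnm0E subnn.
by rewrite mpolyX0 rmorph1.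
Qed.

(** The derivation along the Euler field [\sum_i w_i x_i d/dx_i]. *)
Definition euler w a : ps := \sum_i (w i)%:R *: (px i * pD i a).

Lemma eulerE w a m : euler w a m = (wt w m)%:R * a m.
Proof.
rewrite /euler pser_sum /wt natr_sum mulr_suml; apply: eq_bigr => i _.
by rewrite pserZ px_pD natrM mulrA.
Qed.

Lemma eulerM w a b : euler w (a * b) = euler w a * b + a * euler w b.
Proof.
rewrite /euler mulr_suml mulr_sumr -big_split; apply: eq_bigr => i _ /=.
by rewrite pDM -scalerAl -scalerAr -scalerDr; congr (_ *: _); ring.
Qed.

Lemma pD_euler w i a : pD i (euler w a) = euler w (pD i a) + (w i)%:R *: pD i a.
Proof.
apply/funext => m; rewrite pDE pserD pserZ !eulerE !pDE wtD wt1 natrD.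
by rewrite -mulrnAr mulrDl.
Qed.

Lemma qh_homog w N (f : mpoly n K) :
    \sum_(i < n) (w i)%:R *: (mpolyX K (mnm1 i) * mderiv i f) = N%:R *: f ->
  euler w (pser_poly f) = N%:R *: pser_poly f.
Proof.
move=> E; rewrite -linearZ -E linear_sum; apply: eq_bigr => i _.
by rewrite pD_poly [RHS]linearZ /= rmorphM.
Qed.

Lemma homog_supp w N a m : euler w a = N%:R *: a -> a m != 0 -> wt w m = N.
Proof.
move=> /(congr1 (fun a : ps => a m)); rewrite eulerE pserZ => /eqP E am.
by move: E; rewrite (inj_eq (mulIf am)) eqr_nat => /eqP.
Qed.

Lemma homog_pD_supp w N a i m :
  euler w a = N%:R *: a -> pD i a m != 0 -> (wt w m + w i)%N = N.
Proof.
move=> Ea; rewrite pDE -mulr_natl mulf_eq0 pnatr_eq0 /=.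
by move=> /(homog_supp Ea); rewrite wtD wt1.
Qed.

End Weights.

Section LeadingMonomial.
Variables (K : numFieldType) (n : nat).
Local Notation ps := (pser K n).
Local Notation mon := (multinom n).

Lemma digits_inj B q (u v : 'I_q -> nat) :
    (forall i, u i < B)%N -> (forall i, v i < B)%N ->
  (\sum_(i < q) B ^ i * u i = \sum_(i < q) B ^ i * v i)%N -> u =1 v.
Proof.
elim: q u v => [|q IH] u v uB vB; first by move=> _ [].
have B0 : (0 < B)%N by apply: leq_trans (uB ord0).
have E (x : 'I_q.+1 -> nat) : (\sum_(i < q.+1) B ^ i * x i =
    (\sum_(i < q) B ^ i * x (lift ord0 i)) * B + x ord0)%N.
  rewrite big_ord_recl expn0 mul1n addnC big_distrl; congr addn.
  by apply: eq_bigr => i _; rewrite /= /bump /= expnS; ring.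
rewrite !E => H i.
have H0 : u ord0 = v ord0.
  by have := congr1 (modn^~ B) H; rewrite !modnMDl !modn_small.
have H1 : (\sum_(i < q) B ^ i * u (lift ord0 i) = \sum_(i < q) B ^ i * v (lift ord0 i))%N.
  by have := congr1 (divn^~ B) H; rewrite !divnMDl // !divn_small ?addn0.
case: (unliftP ord0 i) => [j|] ->//.
by apply: (IH (fun j => u (lift ord0 j)) (fun j => v (lift ord0 j))).
Qed.

(** The linear form reads exponents as digits in a large base, hence separates the
    monomials of [p] and has a unique minimum among them. *)
Lemma lead_monomial (p : mpoly n K) : p != 0 ->
  exists (l : 'I_n -> nat) (m0 : mon), [/\ forall i, (0 < l i)%N, mcoeff m0 p != 0 &
    forall k, k \in msupp p -> k != m0 -> (wt l m0 < wt l k)%N].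
Proof.
move=> p0; set B := (mmeasure mdeg p).+1; pose l (i : 'I_n) := (B ^ i)%N.
have small m i : m \in msupp p -> (m i < B)%N.
  move=> /msize_mdeg_lt mp; rewrite ltnW // ltnS; apply: leq_ltn_trans mp.
  by rewrite mdegE (bigD1 i) //= leq_addr.
pose P d := has (fun m => wt l m == d) (msupp p).
have exP : exists d, P d.
  exists (wt l (mlead p)); apply/hasP; exists (mlead p) => //.
  by rewrite mlead_supp.
case: (ex_minnP exP) => d /hasP[m0 m0p /eqP m0d] dmin.
exists l, m0; split=> [i||k kp km]; first by rewrite expn_gt0.
  by rewrite -mcoeff_msupp.
rewrite ltn_neqAle m0d dmin ?andbT; last by apply/hasP; exists k.
apply: contra_neq km; rewrite -m0d => E; apply/mnmP => i.
by apply: (digits_inj (B := B)) => // j; apply: small.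
Qed.

(** Singling out the monomial [m0] of [p] solves the convolution [p * q] for the
    coefficient of [q] at [m]; with [m0] leading, the coefficients of [q] in the remaining
    sum have smaller weight. *)
Lemma pser_polyM_lead (p : mpoly n K) (q : ps) (m0 m : mon) : mcoeff m0 p != 0 ->
  (pser_poly p * q) (m0 ++m m) = mcoeff m0 p * q m +
    \sum_(k <- msupp p | k != m0) mcoeff k p *
      (if lem k (m0 ++m m) then q (mnm_sub (m0 ++m m) k) else 0).
Proof.
move=> m0p; rewrite {1}[p]mpolyE linear_sum mulr_suml pser_sum /=.
rewrite (bigD1_seq m0) ?msupp_uniq ?mcoeff_msupp //=; congr (_ + _).
  by rewrite linearZ /= -scalerAl pserZ pserXM.
by apply: eq_bigr => k _; rewrite linearZ /= -scalerAl pserZ pXM.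
Qed.

Lemma wt_lead_drop l (m0 m k : mon) : lem k (m0 ++m m) -> (wt l m0 < wt l k)%N ->
  (wt l (mnm_sub (m0 ++m m) k) + (wt l k - wt l m0) = wt l m)%N.
Proof. by move=> /submK /(congr1 (wt l)); rewrite !wtD; lia. Qed.

Lemma poly_lreg (p : mpoly n K) : p != 0 -> GRing.lreg (pser_poly p).
Proof.
move=> /lead_monomial[l [m0 [_ m0p lmin]]].
suff H q : pser_poly p * q = 0 -> q = 0.
  by move=> a b ab; apply/eqP; rewrite -subr_eq0 (H (a - b)) // mulrBr ab subrr.
move=> pq; apply/funext => m; have [d] := ubnP (wt l m).
elim: d m => // d IH m md.
have := congr1 (fun a : ps => a (m0 ++m m)) pq; rewrite pser_polyM_lead // big1_seq.
  by rewrite addr0 => /eqP; rewrite mulf_eq0 (negbTE m0p) => /eqP.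
move=> k /andP[km kp]; case: ifP => [km0|_]; last by rewrite mulr0.
rewrite IH ?mulr0 //; have := wt_lead_drop km0 (lmin _ kp km).
by have := lmin _ kp km; lia.
Qed.

End LeadingMonomial.

(** * Formal cocycles *)

Section FormalCocycles.
Variables (K : numFieldType) (n : nat) (w : 'I_n -> nat) (N : nat) (f : pser K n).
Local Notation ps := (pser K n).
Local Notation mon := (multinom n).
Hypothesis w0 : forall i, (0 < w i)%N.
Hypothesis fN : euler w f = N%:R *: f.
Hypothesis f0 : f mnm0 = 0.
Hypothesis freg : GRing.lreg f.
Local Notation F := (fun i => pD i f).

Lemma homog_degree_neq0 : N != 0%N.
Proof.
apply/eqP => N0; have fE : f = 0.
  apply/funext => m; apply/eqP; apply: contraT => fm.
  have := homog_supp fN fm; rewrite N0 => /(wt_eq0 w0) mE.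
  by rewrite mE f0 eqxx in fm.
by have /eqP := @freg 1 0 (etrans (mulr1 f) (etrans fE (esym (mulr0 f)))); rewrite oner_eq0.
Qed.

(** The Jacobian ideal is generated by weighted homogeneous elements, so it contains the
    weighted homogeneous components of its members; that of weight [k * w i] in
    the given combination is a nonzero scalar multiple of one power. *)
Lemma ideal_weight_component (i : 'I_n) q (c : 'I_q -> K) (k : 'I_q) : c k != 0 ->
    in_ideal F (\sum_(j < q) c j *: xpow K i j) ->
  in_ideal F (xpow K i k).
Proof.
move=> ck [h hE].
exists (fun j => (c k)^-1 *: ((fun m => if (wt w m + N == k * w i + w j)%N then h j m else 0) : ps)).
apply: (scalerI ck); rewrite scaler_sumr.
under eq_bigr do rewrite -scalerAl scalerA divff // scale1r.
have wtx (j : nat) : wt w (mnm_muln (mnm1 i) j) = (j * w i)%N by rewrite wtMn wt1 mulnC.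
apply/funext => m; rewrite pserZ pser_sum.
have [mk|mk] := eqVneq (wt w m) (k * w i)%N.
  transitivity ((\sum_j h j * F j) m).
    rewrite -hE pser_sum (bigD1 k) //= pserZ big1 ?addr0 // => j jk.
    rewrite pserZ /xpow /pX /pser_poly mcoeffX; case: eqP => [mE|]; last by rewrite mulr0.
    move: mk; rewrite -mE wtx => /eqP; rewrite eqn_pmul2r // => /eqP /val_inj E.
    by rewrite E eqxx in jk.
  rewrite pser_sum; apply: eq_bigr => j _; apply: pserM_eq => k1 k2 mE.
  have [->|/(homog_pD_supp fN) wk2] := eqVneq (pD j f k2) 0; first by rewrite !mulr0.
  by rewrite -mk mE wtD -addnA wk2 eqxx.
rewrite big1 => [|j _].
  rewrite /xpow /pX /pser_poly mcoeffX; case: eqP => [mE|]; last by rewrite mulr0.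
  by rewrite -mE wtx eqxx in mk.
apply: pserM_eq0 => k1 k2 mE.
have [->|/(homog_pD_supp fN) wk2] := eqVneq (pD j f k2) 0; first by rewrite !mulr0.
case: eqP => [wk1|_]; last by rewrite mul0r.
by move: mk; rewrite mE wtD; case/eqP; lia.
Qed.

(** Pairing with the Euler field turns [c df = f dg] into [c N f = f E g], and [E g] has
    no constant term. *)
Lemma df_not_exact (c : K) (g : ps) :
  (forall i, c *: F i = f * pD i g) -> c = 0.
Proof.
move=> H; have E : c *: euler w f = f * euler w g.
  rewrite /euler scaler_sumr mulr_sumr; apply: eq_bigr => i _.
  by rewrite scalerA mulrC -scalerA scalerAr H -scalerAr; congr (_ *: _); ring.
have /freg : f * (c * N%:R)%:A = f * euler w g.
  by rewrite -E fN -scalerAr mulr1 scalerA.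
move=> /(congr1 (fun a : ps => a mnm0)); rewrite eulerE wt0 mul0r pserZ.
rewrite pser1 eqxx => /eqP; rewrite mulr1 mulf_eq0 pnatr_eq0 (negbTE homog_degree_neq0) orbF.
by move/eqP.
Qed.

Variables (i1 i2 i3 : 'I_n) (k1 k2 k3 : nat).
Hypotheses (i12 : i1 != i2) (i13 : i1 != i3) (i23 : i2 != i3).
Hypothesis I1 : in_ideal F (xpow K i1 k1).
Hypothesis I2 : in_ideal F (xpow K i2 k2).
Hypothesis I3 : in_ideal F (xpow K i3 k3).

(** The equation [f dA = df /\ A] in components. *)
Definition closed1 (A : 'I_n -> ps) : Prop :=
  forall i j, f * (pD i (A j) - pD j (A i)) = F i * A j - F j * A i.

Lemma divide1 (om : 'I_n -> ps) :
    (forall i j, F i * om j = F j * om i) -> exists u, forall i, om i = F i * u.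
Proof.
by move=> H; apply: (koszul1 I1 I2 (@xpow_lreg _ _ _ _) _ H) => u v; apply: xpow_reg2.
Qed.

Lemma divide2 (om : 'I_n -> 'I_n -> ps) :
    (forall i j, om i j = - om j i) ->
    (forall i j k, F i * om j k + F j * om k i + F k * om i j = 0) ->
  exists u : 'I_n -> ps, forall j k, om j k = F j * u k - F k * u j.
Proof.
move=> H H'; apply: (koszul2 I1 I2 I3 (@xpow_lreg _ _ _ _) _ _ H H') => [u v|u v v'].
  exact: xpow_reg2.
exact: xpow_reg3.
Qed.

(** This is [(L_E - N) A = f db] in components: [L_E] acts on the coefficient of [dx_j]
    by [euler w + w j].  It results from contracting the cocycle equation with [E], dividing
    by [df] and applying Cartan's formula. *)
Lemma closed1_divide A : closed1 A ->
  exists b, forall j, euler w (A j) = N%:R *: A j - (w j)%:R *: A j + f * pD j b.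
Proof.
move=> cA; pose a := \sum_i (w i)%:R *: (px K i * A i).
pose c j := N%:R *: A j - \sum_i (w i)%:R *: (px K i * (pD i (A j) - pD j (A i))).
(* [a] is the contraction of [A] with the Euler field and [c] is [N A - i_E dA]. *)
have fc j : f * c j = F j * a.
  rewrite /c mulrBr mulr_sumr.
  under eq_bigr => i _ do rewrite -scalerAr mulrCA cA.
  have -> : \sum_i (w i)%:R *: (px K i * (F i * A j - F j * A i)) = euler w f * A j - F j * a.
    rewrite /euler /a mulr_suml mulr_sumr -sumrB; apply: eq_bigr => i _.
    by rewrite -scalerAl -scalerAr -scalerBr; congr (_ *: _); ring.
  by rewrite fN -scalerAr -scalerAl; ring.
have /divide1 [b bE] i j : F i * c j = F j * c i.
  by apply: freg; rewrite !(mulrCA f) !fc; ring.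
have aE : a = f * b.
  apply/eqP; rewrite -subr_eq0; apply/eqP.
  apply: (koszul0 I1 (@xpow_lreg _ _ _ _)) => j.
  by rewrite mulrBr -fc bE; ring.
exists b => j; have := bE j; rewrite /c.
have -> : \sum_i (w i)%:R *: (px K i * (pD i (A j) - pD j (A i))) =
    euler w (A j) - (pD j a - (w j)%:R *: A j).
  have -> : (w j)%:R *: A j = \sum_i (w i)%:R *: ((j == i)%:R * A i).
    rewrite (bigD1 j) //= eqxx mul1r big1 ?addr0 // => i ij.
    by rewrite eq_sym (negbTE ij) mul0r scaler0.
  rewrite /euler /a linear_sum -!sumrB; apply: eq_bigr => i _.
  rewrite linearZ /= pDM pD_px -!scalerBr; congr (_ *: _); ring.
move/eqP; rewrite aE pDM -subr_eq0 => /eqP H.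
by apply/eqP; rewrite -subr_eq0 -oppr_eq0 -H; apply/eqP; ring.
Qed.

Lemma closed1_coboundary g : closed1 (fun j => f * pD j g).
Proof. by move=> i j; rewrite !pDM (pDC j i); ring. Qed.

Lemma closed1B A B : closed1 A -> closed1 B -> closed1 (fun j => A j - B j).
Proof.
move=> cA cB i j; rewrite !linearB /=.
transitivity (f * (pD i (A j) - pD j (A i)) - f * (pD i (B j) - pD j (B i))); first by ring.
by rewrite cA cB; ring.
Qed.

(** The quotient of [dA] by [df] would be a 1-form of weight 0, but the [dx_i] have
    positive weight; so [A] is closed.  A second division by [df] then leaves a factor of
    weight 0, that is a constant. *)
Lemma closed1_pure A : closed1 A ->
    (forall j m, A j m != 0 -> (wt w m + w j)%N = N) ->
  exists c : K, forall j, A j = c *: F j.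
Proof.
move=> cA wA; pose om i j := pD i (A j) - pD j (A i).
have [||u uE] := @divide2 om.
- by move=> i j; rewrite opprB.
- move=> i j k; apply: freg.
  transitivity (F i * (f * om j k) + F j * (f * om k i) + F k * (f * om i j)); first by ring.
  by rewrite mulr0 !cA; ring.
have wDA i j m : pD i (A j) m != 0 -> (wt w m + w i + w j)%N = N.
  by rewrite pDE -mulr_natl mulf_eq0 pnatr_eq0 /= => /wA; rewrite wtD wt1.
(* A coefficient of [u j] contributing here would sit in weight [- w j]. *)
have low i j m : (wt w m + w i + w j)%N = N -> (F i * u j) m = 0.
  move=> wm; apply: pserM_eq0 => l1 l2 mE.
  have [->|/(homog_pD_supp fN)] := eqVneq (F i l1) 0; first by rewrite mul0r.
  by have := w0 j; move: wm; rewrite mE wtD; lia.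
have om0 i j : om i j = 0.
  apply/funext => m; rewrite pser0; have [wm|wm] := eqVneq (wt w m + w i + w j)%N N.
    by rewrite uE pserD pserN !low ?subrr // addnAC.
  rewrite /om pserD pserN.
  have [->|/wDA/eqP] := eqVneq (pD i (A j) m) 0; last by rewrite (negbTE wm).
  have [->|/wDA/eqP] := eqVneq (pD j (A i) m) 0; last by rewrite addnAC (negbTE wm).
  by rewrite subr0.
have /divide1 [b bE] i j : F i * A j = F j * A i.
  by apply/eqP; rewrite -subr_eq0 -cA -/(om i j) om0 mulr0.
exists (b mnm0) => j; apply/funext => m; rewrite pserZ bE.
have [wm|wm] := eqVneq (wt w m + w j)%N N; last first.
  have [->|/(homog_pD_supp fN)/eqP] := eqVneq (F j m) 0; last by rewrite (negbTE wm).
  rewrite mulr0 -bE; apply/eqP; apply: contraNT wm => /wA ->; exact: eqxx.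
have -> : b mnm0 * F j m = (F j * (b mnm0)%:A) m by rewrite -scalerAr mulr1.
apply: pserM_eq => l1 l2 mE; rewrite pserZ.
rewrite pser1; have [->|l20] := eqVneq l2 mnm0; first by rewrite mulr1.
have [->|/(homog_pD_supp fN) wl1] := eqVneq (F j l1) 0; first by rewrite !mul0r.
case/eqP: l20; apply: (wt_eq0 w0).
by move: wm; rewrite mE wtD; lia.
Qed.

(** [L_E - N] is diagonal on monomials, so the equation of [closed1_divide] is solved by
    dividing the coefficients of [b] by their weights; what remains is of pure weight. *)
Lemma closed1_spanned A : closed1 A ->
  exists c g, forall j, A j = c *: F j + f * pD j g.
Proof.
move=> cA; have [b bE] := closed1_divide cA.
(* At weight 0 the division yields 0; only the derivatives of [b] matter. *)
pose g : ps := fun m => b m / (wt w m)%:R.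
have Eg i : pD i (euler w g) = pD i b.
  apply/funext => m; rewrite !pDE eulerE /g mulrCA divff ?mulr1 //.
  by rewrite pnatr_eq0 wtD wt1 -lt0n addn_gt0 w0 orbT.
have [||c cE] := @closed1_pure (fun j => A j - f * pD j g).
- exact: closed1B cA (closed1_coboundary g).
- move=> j m; pose B := A j - f * pD j g.
  have EB : euler w B = N%:R *: B - (w j)%:R *: B.
    rewrite /B /euler; under eq_bigr do rewrite linearB mulrBr scalerBr.
    rewrite sumrB -!/(euler _ _) eulerM fN bE.
    have -> : euler w (pD j g) = pD j b - (w j)%:R *: pD j g.
      by rewrite -Eg pD_euler; ring.
    by rewrite !scalerBr mulrBr -scalerAl -!scalerAr; ring.
  move=> Bm; have := congr1 (fun a : ps => a m) EB.
  rewrite eulerE pserD pserN !pserZ -mulrBl => /(mulIf Bm)/eqP.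
  by rewrite eq_sym subr_eq -natrD eqr_nat => /eqP.
by exists c, g => j; rewrite -cE subrK.
Qed.

End FormalCocycles.

(** * Components of forms of degree at most 2 *)

Section FormalForms.
Variables (K : numFieldType) (n : nat).
Local Notation G := (formal_germs K n).
Local Notation form := Defs.form.
Local Notation ps := (pser K n).

Fact k1_subproof (i : 'I_n) : #|[set i]%SET| == 1%N. Proof. by rewrite cards1. Qed.
Definition k1 i : kset n 1 := exist _ [set i]%SET (k1_subproof i).
Fact k0_subproof : #|(set0 : {set 'I_n})| == 0%N. Proof. by rewrite cards0. Qed.
Definition k0 : kset n 0 := exist _ set0 k0_subproof.

Lemma k1P (J : kset n 1) : exists i, J = k1 i.
Proof.
have /cards1P[i iE] := valP J; exists i; exact: val_inj.
Qed.

Lemma k0P (J : kset n 0) : J = k0.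
Proof. by apply: val_inj => /=; apply/eqP; rewrite -cards_eq0; apply: (valP J). Qed.

Lemma k1_inj : injective k1.
Proof. by move=> i j /(congr1 val) /= /set1_inj. Qed.

Lemma k2P (I : kset n 2) : exists i j : 'I_n, (i < j)%N /\ val I = [set i; j]%SET.
Proof.
have /cards2P[i [j [ij IE]]] := valP I.
case: (ltngtP i j) => [lt|lt|/val_inj E]; last by rewrite E eqxx in ij.
  by exists i, j.
by exists j, i; rewrite setUC.
Qed.

Fact k2_subproof (i j : 'I_n) : (i < j)%N -> #|[set i; j]%SET| == 2.
Proof. by move=> ij; rewrite cards2 (_ : i != j) // neq_ltn ij. Qed.
Definition k2 i j ij : kset n 2 := exist _ [set i; j]%SET (@k2_subproof i j ij).

Lemma big_kset1 (V : nmodType) (P : pred (kset n 1)) (H : kset n 1 -> V) :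
  \sum_(J | P J) H J = \sum_(i | P (k1 i)) H (k1 i).
Proof.
apply: (reindex k1); apply: onW_bij.
exists (fun J => projT1 (cid (k1P J))) => [i|J]; case: cid => j /=; first by move/k1_inj.
by move=> ->.
Qed.

Lemma big_kset0 (V : nmodType) (P : pred (kset n 0)) (H : kset n 0 -> V) :
  \sum_(J | P J) H J = if P k0 then H k0 else 0.
Proof.
rewrite (eq_bigl (fun J => (J == k0) && P k0)) => [|J]; last by rewrite (k0P J) eqxx.
case: (P k0); last by rewrite big1 // => J; rewrite andbF.
by under eq_bigl do rewrite andbT; rewrite big_pred1_eq.
Qed.

Lemma shuffle_sign1 (i j : 'I_n) : shuffle_sign K [set i] [set j] = (-1) ^+ (j < i)%N.
Proof.
rewrite /shuffle_sign; congr (_ ^+ _).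
have -> : [set p : 'I_n * 'I_n | [&& p.1 \in [set i], p.2 \in [set j] & (p.2 < p.1)%N]]%SET
    = if (j < i)%N then [set (i, j)]%SET else set0.
  apply/setP => -[x y]; rewrite !inE /=; case: ifP => ji.
    rewrite inE xpair_eqE; case: eqP => //= ->; case: eqP => //= ->; exact: ji.
  by rewrite inE; case: eqP => //= ->; case: eqP => //= ->.
by case: (j < i)%N; rewrite ?cards1 ?cards0.
Qed.

Lemma shuffle_sign_0r (J : {set 'I_n}) : shuffle_sign K J set0 = 1.
Proof.
rewrite /shuffle_sign [X in pred_of_set X](_ : _ = set0) ?cards0 //.
by apply/setP => p; rewrite !inE andbF.
Qed.

Lemma wedge10 (a : form G 1) (b : form G 0) i :
  wedge a b (k1 i) = (a (k1 i) : ps) * (b k0 : ps).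
Proof.
rewrite ffunE big_kset1 (bigD1 i) //= big_kset0 /= setU0 eqxx disjoint_sym.
rewrite disjoints_subset finset.sub0set /= shuffle_sign_0r scale1r big1 ?addr0 // => j ji.
rewrite big_kset0 /= setU0; case: eqP => [/set1_inj/eqP|_]; last by rewrite andbF.
by rewrite (negbTE ji).
Qed.

Lemma set2_eq (i j k l : 'I_n) : i != j ->
  ([disjoint [set k] & [set l]]%SET && ([set k] :|: [set l] == [set i; j])%SET) =
  ((k == i) && (l == j)) || ((k == j) && (l == i)).
Proof.
move=> ij; rewrite disjoints1 inE; apply/andP/orP.
  case=> kl /eqP/setP E; have := E i; have := E j.
  rewrite !inE !eqxx orbT /= => /orP[] /eqP jE /orP[] /eqP iE; subst.
  - by rewrite eqxx in ij.
  - by right; rewrite !eqxx.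
  - by left; rewrite !eqxx.
  - by rewrite eqxx in ij.
case=> /andP[/eqP -> /eqP ->]; first by [].
by rewrite eq_sym setUC.
Qed.

Lemma wedge11 (a b : form G 1) (i j : 'I_n) ij :
  wedge a b (@k2 i j ij) =
    (a (k1 i) : ps) * (b (k1 j) : ps) - (a (k1 j) : ps) * (b (k1 i) : ps).
Proof.
have ij' : i != j by rewrite neq_ltn ij.
rewrite ffunE big_kset1 (bigD1 i) //= (bigD1 j) 1?eq_sym //=.
rewrite big_kset1 (big_pred1 j); last first.
  by move=> l /=; rewrite set2_eq // eqxx (negbTE ij') orbF.
rewrite big_kset1 (big_pred1 i); last first.
  by move=> l /=; rewrite set2_eq // eqxx eq_sym (negbTE ij').
rewrite big1 ?addr0 => [|k /andP[ki kj]]; last first.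
  rewrite big_kset1 big_pred0 // => l /=.
  by rewrite set2_eq // (negbTE ki) (negbTE kj).
rewrite !shuffle_sign1 ij ltnNge (ltnW ij) /= expr0 expr1 scale1r scaleN1r.
by [].
Qed.

Lemma dx_k1 i j : (dx G i (k1 j) : ps) = (i == j)%:R.
Proof.
rewrite ffunE /=; case: eqP => [/set1_inj ->|]; first by rewrite eqxx.
by case: eqP => // ->.
Qed.

Lemma ext_d0 (b : form G 0) i : ext_d b (k1 i) = pD i (b k0 : ps).
Proof.
rewrite /ext_d sum_ffunE (eq_bigr (fun l => (l == i)%:R * pD l (b k0 : ps))) => [|l _].
  rewrite (bigD1 i) //= eqxx mul1r big1 ?addr0 // => l li.
  by rewrite (negbTE li) mul0r.
by rewrite -dx_k1 wedge10 !ffunE.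
Qed.

Lemma ext_d1 (a : form G 1) i j ij :
  ext_d a (@k2 i j ij) = pD i (a (k1 j) : ps) - pD j (a (k1 i) : ps).
Proof.
rewrite /ext_d sum_ffunE (eq_bigr (fun l => (l == i)%:R * pD l (a (k1 j) : ps) - (l == j)%:R * pD l (a (k1 i) : ps))) => [|l _].
  rewrite sumrB (bigD1 i) //= eqxx mul1r big1 ?addr0 => [|l li]; last by rewrite (negbTE li) mul0r.
  rewrite (bigD1 j) //= eqxx mul1r big1 ?addr0 // => l lj; by rewrite (negbTE lj) mul0r.
by rewrite -!dx_k1 wedge11 !ffunE.
Qed.

Lemma dfun_k1 (f : ps) i : dfun (f : G) (k1 i) = pD i f.
Proof. by rewrite /dfun ext_d0 ffunE. Qed.

Lemma d_f0 (f : ps) (b : form G 0) i : d_f (f : G) b (k1 i) = f * pD i (b k0 : ps).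
Proof. by rewrite /d_f !ffunE scale0r subr0 ext_d0. Qed.

Lemma d_f1 (f : ps) (a : form G 1) i j ij : d_f (f : G) a (@k2 i j ij) =
  f * (pD i (a (k1 j) : ps) - pD j (a (k1 i) : ps))
   - (pD i f * (a (k1 j) : ps) - pD j f * (a (k1 i) : ps)).
Proof.
have -> : d_f (f : G) a (k2 ij) = f * (ext_d a (k2 ij) : ps) - (wedge (dfun (f : G)) a (k2 ij) : ps).
  by rewrite /d_f !ffunE scale1r.
by rewrite ext_d1 wedge11 !dfun_k1.
Qed.

End FormalForms.

(** * Passing from germs to Taylor series *)

(** What is required of a category of germs for the formal argument to apply: [T h a]
    reads that [a] is the Taylor series of [h].  The last field makes the
    primitive found among formal series a germ. *)
Record taylor (K : numFieldType) n (F : germs K n) (T : F -> pser K n -> Prop) : Prop := Taylor {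
  taylor_mem : forall h, germ_mem h <-> exists a, T h a;
  taylor_eq : forall h h' a a', T h a -> T h' a' -> (germ_eq h h' <-> a = a');
  taylorD : forall h h' a a', T h a -> T h' a' -> T (h + h') (a + a');
  taylorZ : forall x h a, T h a -> T (x *: h) (x *: a);
  taylorM : forall h h' a a', T h a -> T h' a' -> T (germ_mul h h') (a * a');
  taylor_der : forall i h a, T h a -> T (germ_der i h) (pD i a);
  taylor_poly : forall p, T (germ_poly F p) (pser_poly p);
  taylor_div : forall p, p != 0 -> forall b,
    (forall i, exists h, T h (pser_poly p * pD i b)) -> exists h, T h b }.

Section Transfer.
Variables (K : numFieldType) (n : nat) (F : germs K n) (T : F -> pser K n -> Prop).
Hypothesis HT : taylor T.
Local Notation G := (formal_germs K n).
Local Notation form := Defs.form.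
Local Notation ps := (pser K n).

Lemma taylor0 : T 0 0.
Proof.
by have := taylorZ HT 0 (taylor_poly HT 0); rewrite !scale0r.
Qed.

Lemma taylorB h h' a a' : T h a -> T h' a' -> T (h - h') (a - a').
Proof.
by move=> ha /(taylorZ HT (-1)); rewrite !scaleN1r => /(taylorD HT ha).
Qed.

Lemma taylor_sum (I : Type) (r : seq I) (P : pred I) (h : I -> F) (a : I -> ps) :
  (forall i, T (h i) (a i)) -> T (\sum_(i <- r | P i) h i) (\sum_(i <- r | P i) a i).
Proof.
move=> ha; elim/big_rec2: _ => [|i y x _ xy]; first exact: taylor0.
exact: taylorD.
Qed.

Definition taylor_form k (al : form F k) (A : form G k) := forall I, T (al I) (A I).

Lemma taylor_wedge p q (al : form F p) (be : form F q) A B :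
  taylor_form al A -> taylor_form be B -> taylor_form (wedge al be) (wedge A B).
Proof.
move=> aA bB I; rewrite !ffunE; apply: taylor_sum => J; apply: taylor_sum => L.
by apply: taylorZ => //; apply: (taylorM HT).
Qed.

Lemma taylor_dx i : taylor_form (dx F i) (dx G i).
Proof. by move=> I; rewrite !ffunE; case: eqP => _; [apply: (taylor_poly HT)|apply: taylor0]. Qed.

Lemma taylor_ext_d k (al : form F k) A :
  taylor_form al A -> taylor_form (ext_d al) (ext_d A).
Proof.
move=> aA I; rewrite /ext_d !sum_ffunE; apply: taylor_sum => i.
apply: taylor_wedge; first exact: taylor_dx.
by move=> J; rewrite !ffunE; apply: (taylor_der HT).
Qed.

Lemma taylor_dfun h (a : ps) : T h a -> taylor_form (dfun h) (dfun (a : G)).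
Proof. by move=> ha; apply: taylor_ext_d => I; rewrite !ffunE. Qed.

Lemma taylor_d_f h (a : ps) k (al : form F k) A : T h a -> taylor_form al A ->
  taylor_form (d_f h al) (d_f (a : G) A).
Proof.
move=> ha aA I.
have dfE (F' : germs K n) (x : F') (x' : form F' k) :
    d_f x x' I = germ_mul x (ext_d x' I) - k%:R *: (wedge (dfun x) x' : form F' (1 + k)) I.
  by rewrite /d_f !ffunE.
rewrite !dfE; apply: taylorB.
  by apply: (taylorM HT) => //; apply: taylor_ext_d.
by apply: (taylorZ HT); apply: (taylor_wedge (taylor_dfun ha)).
Qed.

Lemma taylor_formP k (al : form F k) : is_form al <-> exists A, taylor_form al A.
Proof.
split=> [ex|[A aA] I]; last by apply/(taylor_mem HT); exists (A I).
have /choice[A aA] I : exists a : ps, T (al I) a by apply/(taylor_mem HT)/ex.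
by exists [ffun I => A I] => I; rewrite ffunE.
Qed.

Lemma taylor_form_eq k (al be : form F k) A B : taylor_form al A -> taylor_form be B ->
  form_eq al be <-> A =1 B.
Proof. by move=> aA bB; split=> H I; apply/(taylor_eq HT (aA I) (bB I))/H. Qed.

Variable f : mpoly n K.
Local Notation fg := (germ_poly F f).
Local Notation fs := (pser_poly f).

Lemma taylor_cocycle (al : form F 1) : cocycle fg al <->
  exists2 A : form G 1, taylor_form al A & closed1 fs (fun i => A (k1 i)).
Proof.
have T0 : taylor_form (0 : form F 2) (0 : form G 2) by move=> I; rewrite !ffunE; apply: taylor0.
have TA A := taylor_d_f (taylor_poly HT f) (k := 1) (al := al) (A := A).
split=> [[/taylor_formP[A aA] /(taylor_form_eq (TA _ aA) T0) E]|[A aA cA]].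
  exists A => //.
  have H (i j : 'I_n) : (i < j)%N -> fs * (pD i (A (k1 j) : ps) - pD j (A (k1 i) : ps)) =
      pD i fs * (A (k1 j) : ps) - pD j fs * (A (k1 i) : ps).
    move=> ij; apply/eqP; rewrite -subr_eq0; apply/eqP.
    by have := E (k2 ij); rewrite d_f1 ffunE.
  move=> i j; case: (ltngtP i j) => [/H //|/H ji|/val_inj ->]; last by rewrite !subrr mulr0.
  by apply: oppr_inj; rewrite opprB -ji; ring.
split; first by apply/taylor_formP; exists A.
apply/(taylor_form_eq (TA _ aA) T0) => I; have [i [j [ij IE]]] := k2P I.
have -> : I = k2 ij by apply: val_inj.
by rewrite d_f1 ffunE cA subrr.
Qed.

Lemma taylor_coboundary (al : form F 1) (A : form G 1) : taylor_form al A ->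
  coboundary fg al <-> exists2 b : ps, (exists h, T h b) & forall i, A (k1 i) = fs * pD i b.
Proof.
move=> aA; split=> [[be [/taylor_formP[B bB] E]]|[b [h hb] E]].
  exists (B (k0 n)); first by exists (be (k0 n)).
  move=> i; have /(taylor_form_eq aA) := E.
  by move=> /(_ _ (taylor_d_f (taylor_poly HT f) bB)) ->; rewrite d_f0.
have bB : taylor_form (form0 h) (form0 (b : G)) by move=> I; rewrite !ffunE.
exists (form0 h); split; first by apply/taylor_formP; exists (form0 (b : G)).
apply/(taylor_form_eq aA (taylor_d_f (taylor_poly HT f) bB)) => I.
by have [i ->] := k1P I; rewrite d_f0 ffunE E.
Qed.

Lemma taylor_jacobian_ideal h a : T h a -> jacobian_ideal fg h -> in_ideal (fun i => pD i fs) a.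
Proof.
move=> ha [g [gm]] hE.
have /choice[g' gG] i : exists b, T (g i) b by apply/(taylor_mem HT).
have TS : T (\sum_i germ_mul (g i) (germ_der i fg)) (\sum_i (g' i * pD i fs)).
  apply: taylor_sum => i; apply: (taylorM HT) => //; exact: taylor_der (taylor_poly HT f).
by exists g'; apply/(taylor_eq HT ha TS).
Qed.

(** The first [m + 1] powers of a variable are linearly dependent modulo an ideal of
    codimension [m]; the relation comes from the left kernel of their coordinate matrix. *)
Lemma finite_codimension_power i : finite_codimension fg ->
  exists q (c : 'I_q -> K) (k : 'I_q), c k != 0 /\
    in_ideal (fun i => pD i fs) (\sum_(j < q) c j *: xpow K i j).
Proof.
move=> [m [e [[em span] _]]].
have /choice[E eE] j : exists b, T (e j) b by apply/(taylor_mem HT).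
pose X (j : nat) : mpoly n K := mpolyX K (mnm_muln (mnm1 i) j).
have mX j : germ_mem (germ_poly F (X j)) by apply/(taylor_mem HT); exists (pser_poly (X j)); apply: taylor_poly.
have /choice[C CE] j := span _ (mX j).
pose M : 'M[K]_(m.+1, m) := \matrix_(j, k) C j k.
have : kermx M != 0.
  rewrite -mxrank_eq0 mxrank_ker subn_eq0 -ltnNge.
  exact: leq_ltn_trans (rank_leq_col M) _.
case/rowV0Pn => u /sub_kermxP uM /rV0Pn[k uk].
exists m.+1, (fun j => u 0 j), k; split=> //.
have TX j : T (germ_poly F (X j) - \sum_(k < m) C j k *: e k) (xpow K i j - \sum_(k < m) C j k *: E k).
  apply: taylorB; first exact: taylor_poly.
  by apply: taylor_sum => l; apply: taylorZ.
have /choice[h hE] j := taylor_jacobian_ideal (TX j) (CE j).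
exists (fun l => \sum_(j < m.+1) u 0 j *: h j l).
transitivity (\sum_(j < m.+1) u 0 j *: (xpow K i j - \sum_(k < m) C j k *: E k)).
  under [RHS]eq_bigr do rewrite scalerBr scaler_sumr.
  rewrite sumrB exchange_big /= [X in _ - X]big1 ?subr0 // => l _.
  under eq_bigr do rewrite scalerA.
  rewrite -scaler_suml [X in X *: _](_ : _ = (u *m M) 0 l); last first.
    by rewrite mxE; apply: eq_bigr => j _; rewrite mxE.
  by rewrite uM mxE scale0r.
under eq_bigr do rewrite hE scaler_sumr.
rewrite exchange_big; apply: eq_bigr => l _; rewrite mulr_suml.
by apply: eq_bigr => j _; rewrite scalerAl.
Qed.

Theorem H1_spanned_by_df : (3 <= n)%N -> quasihomogeneous f ->
    meval (fun _ => 0) f = 0 -> finite_codimension fg ->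
  has_dim_mod (cocycle fg (k := 1%N)) (coboundary fg (k := 1%N)) 1 /\
  spans_mod (cocycle fg (k := 1%N)) (coboundary fg (k := 1%N))
    (fun _ : 'I_1 => dfun fg).
Proof.
move=> n3 [N [w [w0 /qh_homog fN]]] f0 cod.
have fs0 : fs mnm0 = 0.
  move: f0; rewrite /pser_poly [in X in X -> _](mpolyE f) raddf_sum /= => H.
  rewrite [in LHS](mpolyE f) raddf_sum /= -[RHS]H; apply: eq_bigr => m _.
  rewrite mcoeffZ mcoeffX mevalZ mevalX; congr (_ * _).
  have [->|m0] := eqVneq m mnm0; first by rewrite big1 // => i _; rewrite mnm0E.
  have [i mi] := mnm_neq0 m0.
  by rewrite (bigD1 i) //= expr0n (negbTE mi) mul0r.
have pow i : exists k, in_ideal (fun i => pD i fs) (xpow K i k).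
  have [q [c [k [ck I]]]] := finite_codimension_power i cod.
  by exists k; exact: (ideal_weight_component w0 fN ck I).
have fn0 : f != 0.
  apply/eqP => fE; have [k [h]] := pow (Ordinal n3).
  rewrite fE big1 => [|i _]; last by rewrite (raddf0 (@pser_poly K n)) raddf0 mulr0.
  move=> /(congr1 (fun a : ps => a (mnm_muln (mnm1 (Ordinal n3)) k))).
  by rewrite /xpow /pX /pser_poly mcoeffX eqxx => /eqP; rewrite oner_eq0.
have freg := poly_lreg fn0.
pose i1 := Ordinal (ltnW (ltnW n3)); pose i2 := Ordinal (ltnW n3); pose i3 := Ordinal n3.
have [e1 I1] := pow i1; have [e2 I2] := pow i2; have [e3 I3] := pow i3.
have Tdf := taylor_dfun (taylor_poly HT f).
have Zdf : cocycle fg (dfun fg).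
  apply/taylor_cocycle; exists (dfun (fs : G)) => // i j.
  by rewrite !dfun_k1 pDC subrr mulr0 mulrC subrr.
have S : spans_mod (cocycle fg (k := 1%N)) (coboundary fg (k := 1%N)) (fun _ : 'I_1 => dfun fg).
  split=> // al /taylor_cocycle[A aA cA].
  have [c [g cg]] := @closed1_spanned K n w N fs w0 fN freg i1 i2 i3 e1 e2 e3 isT isT isT I1 I2 I3 _ cA.
  exists (fun _ => c); rewrite big_ord1.
  have TB : taylor_form (al - c *: dfun fg) (A - c *: dfun (fs : G)).
    move=> I; rewrite !ffunE; apply: taylorB => //; apply: (taylorZ HT); exact: Tdf.
  have E i : (A - c *: dfun (fs : G)) (k1 i) = fs * pD i g.
    by rewrite !ffunE dfun_k1 cg addrC addKr.
  apply/(taylor_coboundary TB); exists g => //.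
  by apply: (taylor_div HT fn0) => i; exists ((al - c *: dfun fg) (k1 i)); rewrite -E; apply: TB.
split=> //; exists (fun _ => dfun fg); split=> // c; rewrite big_ord1.
have TB : taylor_form (c ord0 *: dfun fg) (c ord0 *: dfun (fs : G)).
  by move=> I; rewrite !ffunE; apply: (taylorZ HT); exact: Tdf.
case/(taylor_coboundary TB) => b _ E i; rewrite ord1.
apply: (df_not_exact w0 fN fs0 freg (g := b)) => j.
by rewrite -E ffunE dfun_k1.
Qed.

End Transfer.

Lemma taylor_formal (K : numFieldType) n : @taylor K n (formal_germs K n) eq.
Proof.
split=> //.
- by move=> h; split=> // _; exists h.
- by move=> h h' a a' -> ->.
- by move=> h h' a a' -> ->.
- by move=> x h a ->.
- by move=> h h' a a' -> ->.
- by move=> i h a ->.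
- by move=> p _ b _; exists b.
Qed.

(** * Finite estimates for power series *)

Section Estimates.
Variables (K : numFieldType) (n : nat).
Local Notation ps := (pser K n).
Local Notation mon := (multinom n).
Implicit Types (m k : mon) (a b : ps) (M r : K) (x : 'I_n -> K).

(** The weights of a convergent majorant: their sum over all monomials is [2 ^ n]. *)
Definition geo m : K := 2^-1 ^+ mdeg m.

Lemma geo_ge0 m : 0 <= geo m. Proof. by rewrite exprn_ge0 // invr_ge0 ler0n. Qed.

Lemma geoD m k : geo (m ++m k) = geo m * geo k.
Proof. by rewrite /geo mdegD exprD. Qed.

Lemma geo1_le (B : nat) : \sum_(i < B) 2^-1 ^+ i <= 2 :> K.
Proof.
have -> : \sum_(i < B) 2^-1 ^+ i = 2 - 2 * 2^-1 ^+ B :> K.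
  elim: B => [|B IH]; first by rewrite big_ord0 expr0; ring.
  by rewrite big_ord_recr IH exprS /=; field.
by rewrite gerBl mulr_ge0 ?ler0n // exprn_ge0 // invr_ge0 ler0n.
Qed.

(** The sum over a box is the expansion of a product of [n] geometric series. *)
Lemma geo_sum (s : seq mon) : uniq s -> \sum_(m <- s) geo m <= 2 ^+ n.
Proof.
move=> us; pose B := (\max_(m <- s) mdeg m).+1.
have small m i : m \in s -> (m i < B)%N.
  move=> ms; rewrite ltnS; apply: (@leq_trans (mdeg m)).
    by rewrite mdegE (bigD1 i) //= leq_addr.
  by rewrite (big_rem m) //= leq_maxl.
pose phi m : {ffun 'I_n -> 'I_B} := [ffun i => inord (m i)].
pose g (u : {ffun 'I_n -> 'I_B}) : K := \prod_i 2^-1 ^+ u i.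
have phi_inj : {in s &, injective phi}.
  move=> m m' ms m's /ffunP E; apply/mnmP => i.
  by have := congr1 val (E i); rewrite !ffunE /= !inordK ?small.
have -> : \sum_(m <- s) geo m = \sum_(u <- [seq phi m | m <- s]) g u.
  rewrite big_map; apply: eq_big_seq => m ms.
  rewrite /geo mdegE expr_sum; apply: eq_bigr => i _.
  by rewrite ffunE inordK // small.
have uphi : uniq [seq phi m | m <- s] by rewrite map_inj_in_uniq.
apply: (@le_trans _ _ (\sum_u g u)).
  rewrite big_uniq //= [leRHS](bigID (mem [seq phi m | m <- s])) /= lerDl.
  by apply: sumr_ge0 => u _; apply: prodr_ge0 => i _; rewrite exprn_ge0 // invr_ge0 ler0n.
rewrite /g -(bigA_distr_bigA (fun _ (j : 'I_B) => 2^-1 ^+ j)) /=.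
rewrite prodr_const card_ord lerXn2r ?nnegrE ?ler0n ?geo1_le //.
by apply: sumr_ge0 => i _; rewrite exprn_ge0 // invr_ge0 ler0n.
Qed.

(** Cauchy estimates on the polydisc of radius [r]. *)
Definition bnd M r a := forall m, `|a m| * r ^+ mdeg m <= M.

Definition ev x m : K := \prod_(i < n) x i ^+ m i.

Definition psum N a x : K := \sum_(m : bmultinom n N) a m * ev x m.

Lemma psumE N a x : psum N a x = meval x (trunc N a).
Proof.
rewrite /trunc raddf_sum; apply: eq_bigr => m _ /=.
by rewrite mevalZ mevalX.
Qed.

Lemma bnd_ge0 M r a : 0 <= r -> bnd M r a -> 0 <= M.
Proof. by move=> r0 /(_ mnm0); apply: le_trans; rewrite mulr_ge0 // exprn_ge0. Qed.

Lemma bndW M M' r r' a : 0 <= r' -> r' <= r -> M <= M' -> bnd M r a -> bnd M' r' a.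
Proof.
move=> r0 rr MM B m; apply: le_trans MM; apply: le_trans (B m).
by rewrite ler_wpM2l // lerXn2r // nnegrE // (le_trans r0).
Qed.

Lemma ev_le x r m : 0 <= r -> (forall i, `|x i| <= r) -> `|ev x m| <= r ^+ mdeg m.
Proof.
move=> r0 xr; rewrite normr_prod mdegE expr_sum.
by apply: ler_prod => i _; rewrite normr_ge0 normrX lerXn2r ?nnegrE.
Qed.

(** On the polydisc of radius [r / 4] one factor [geo] is spent on making tails small,
    the other one on summability. *)
Lemma term_le M r a x m : 0 < r -> bnd M r a -> (forall i, `|x i| <= r / 4) ->
  `|a m * ev x m| <= M * geo m * geo m.
Proof.
move=> r0 B xr; rewrite normrM.
apply: (@le_trans _ _ (`|a m| * (r / 4) ^+ mdeg m)).
  by rewrite ler_wpM2l // ev_le // divr_ge0 ?ler0n // ltW.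
have -> : (r / 4) ^+ mdeg m = r ^+ mdeg m * (geo m * geo m).
  by rewrite /geo -exprMn -exprMn; congr (_ ^+ _); field.
by rewrite [leLHS]mulrA -[leRHS]mulrA ler_wpM2r ?B // mulr_ge0 ?geo_ge0.
Qed.

Lemma geo_le m N : (N <= mdeg m)%N -> geo m <= (2 ^+ N)^-1.
Proof.
move=> Nm; rewrite /geo exprVn lef_pV2 ?posrE ?exprn_gt0 ?ltr0n //.
by rewrite ler_weXn2l // ler1n.
Qed.

Lemma tail_le M r a x N (s : seq mon) : 0 < r -> bnd M r a ->
    (forall i, `|x i| <= r / 4) -> uniq s -> (forall m, m \in s -> (N <= mdeg m)%N) ->
  `|\sum_(m <- s) a m * ev x m| <= M * 2 ^+ n / 2 ^+ N.
Proof.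
move=> r0 B xr us sN; apply: le_trans (ler_norm_sum _ _ _) _.
have M0 := bnd_ge0 (ltW r0) B.
apply: (@le_trans _ _ (\sum_(m <- s) M * (2 ^+ N)^-1 * geo m)).
  rewrite big_seq [leRHS]big_seq; apply: ler_sum => m ms.
  apply: le_trans (term_le _ r0 B xr) _.
  by rewrite ler_wpM2r ?geo_ge0 // ler_wpM2l // geo_le // sN.
rewrite -mulr_sumr [leRHS]mulrAC ler_wpM2l ?geo_sum //.
by rewrite divr_ge0 // exprn_ge0 ?ler0n.
Qed.

Definition bmons N : seq mon := [seq val m | m : bmultinom n N].

Lemma bmons_uniq N : uniq (bmons N).
Proof. by rewrite map_inj_uniq ?enum_uniq //; apply: val_inj. Qed.

Lemma mem_bmons N m : (m \in bmons N) = (mdeg m < N)%N.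
Proof.
apply/mapP/idP => [[k _ ->]|mN]; first exact: bmdeg.
by exists (BMultinom mN); rewrite ?mem_enum.
Qed.

Lemma psum_bmons N a x : psum N a x = \sum_(m <- bmons N) a m * ev x m.
Proof. by rewrite big_map big_enum. Qed.

Lemma sum_split_bmons N (H : mon -> K) (s : seq mon) : uniq s -> {subset bmons N <= s} ->
  \sum_(m <- s) H m = \sum_(m <- bmons N) H m + \sum_(m <- [seq m <- s | (N <= mdeg m)%N]) H m.
Proof.
move=> us Ns; rewrite (bigID (fun m => (mdeg m < N)%N)) /=; congr (_ + _).
  rewrite -big_filter; apply: perm_big; apply: uniq_perm.
  - exact: filter_uniq.
  - exact: bmons_uniq.
  move=> m; rewrite mem_filter mem_bmons; case mN: (mdeg m < N)%N => //=.
  by apply: Ns; rewrite mem_bmons.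
by rewrite big_filter; apply: eq_bigl => m; rewrite -leqNgt.
Qed.

Lemma psum_tail M r a x N (s : seq mon) : 0 < r -> bnd M r a ->
    (forall i, `|x i| <= r / 4) -> uniq s -> {subset bmons N <= s} ->
  `|\sum_(m <- s) a m * ev x m - psum N a x| <= M * 2 ^+ n / 2 ^+ N.
Proof.
move=> r0 B xr us Ns; rewrite (sum_split_bmons _ us Ns) psum_bmons addrAC subrr add0r.
apply: (tail_le r0 B xr); first exact: filter_uniq.
by move=> m; rewrite mem_filter => /andP[].
Qed.

Lemma psum_cauchy M r a x N N' : 0 < r -> bnd M r a ->
    (forall i, `|x i| <= r / 4) -> (N <= N')%N ->
  `|psum N' a x - psum N a x| <= M * 2 ^+ n / 2 ^+ N.
Proof.
move=> r0 B xr NN; rewrite [psum N' _ _]psum_bmons; apply: (psum_tail r0 B xr).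
  exact: bmons_uniq.
by move=> m; rewrite !mem_bmons => /leq_trans; apply.
Qed.

Lemma psumD N a b x : psum N (a + b) x = psum N a x + psum N b x.
Proof. by rewrite -big_split; apply: eq_bigr => m _; rewrite pserD mulrDl. Qed.

Lemma psumZ N c a x : psum N (c *: a) x = c * psum N a x.
Proof. by rewrite mulr_sumr; apply: eq_bigr => m _; rewrite pserZ mulrA. Qed.

Lemma bndD M M' r a b : 0 <= r -> bnd M r a -> bnd M' r b -> bnd (M + M') r (a + b).
Proof.
move=> r0 A B m; rewrite pserD; apply: le_trans (lerD (A m) (B m)).
by rewrite -mulrDl ler_wpM2r ?exprn_ge0 // ler_normD.
Qed.

Lemma bndZ M r c a : bnd M r a -> bnd (`|c| * M) r (c *: a).
Proof. by move=> A m; rewrite pserZ normrM -mulrA ler_wpM2l. Qed.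

Lemma geo_pairs (s : seq (mon * mon)) : uniq s ->
  \sum_(k <- s) geo k.1 * geo k.2 <= 4 ^+ n.
Proof.
move=> us; pose N := (\max_(k <- s) maxn (mdeg k.1) (mdeg k.2)).+1.
have E : \sum_(k <- [seq (k1, k2) | k1 <- bmons N, k2 <- bmons N]) geo k.1 * geo k.2 =
    (\sum_(k <- bmons N) geo k) * (\sum_(k <- bmons N) geo k).
  by rewrite big_allpairs mulr_suml; apply: eq_bigr => i _; rewrite mulr_sumr.
have uA : uniq [seq (k1, k2) | k1 <- bmons N, k2 <- bmons N].
  by apply: allpairs_uniq; rewrite ?bmons_uniq // => -[? ?] [].
have sub (k : mon * mon) : k \in s -> k \in [seq (k1, k2) | k1 <- bmons N, k2 <- bmons N].
  case: k => k1 k2 ks; apply/allpairsP; exists (k1, k2) => /=; rewrite !mem_bmons !ltnS.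
  by split=> //; rewrite (big_rem _ ks) /= !leq_max leqnn ?orbT.
set t := [seq (k1, k2) | k1 <- bmons N, k2 <- bmons N] in E uA sub *.
apply: (@le_trans _ _ (\sum_(k <- t) geo k.1 * geo k.2)).
  have -> : \sum_(k <- s) geo k.1 * geo k.2 = \sum_(k <- [seq k <- t | k \in s]) geo k.1 * geo k.2.
    apply: perm_big; apply: uniq_perm => //; first exact: filter_uniq.
    by move=> k; rewrite mem_filter; case ks: (k \in s) => //=; rewrite sub.
  rewrite big_filter [leRHS](bigID (fun k : mon * mon => k \in s)) /= lerDl.
  by apply: sumr_ge0 => k _; rewrite mulr_ge0 ?geo_ge0.
rewrite E (_ : 4 ^+ n = 2 ^+ n * 2 ^+ n); last by rewrite -exprMn -natrM.
by rewrite ler_pM ?geo_sum ?bmons_uniq // sumr_ge0 // => k _; apply: geo_ge0.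
Qed.

Lemma bndM M M' r a b : 0 < r -> bnd M r a -> bnd M' r b -> bnd (M * M' * 4 ^+ n) (r / 2) (a * b).
Proof.
move=> r0 A B m; rewrite pserM.
set P := fun k : bmultinom n (mdeg m).+1 * bmultinom n (mdeg m).+1 => m == mnm_add k.1 k.2.
have M0 := bnd_ge0 (ltW r0) A; have M0' := bnd_ge0 (ltW r0) B.
have h c k Mc : bnd Mc r c -> `|c k| * (r / 2) ^+ mdeg k <= Mc * geo k.
  by move=> C; rewrite exprMn mulrA /geo ler_wpM2r // exprn_ge0 // invr_ge0 ler0n.
have r20 : 0 <= r / 2 by rewrite divr_ge0 ?ler0n // ltW.
apply: (@le_trans _ _ (\sum_(k | P k) M * M' * (geo k.1 * geo k.2))).
  rewrite mulrC; apply: le_trans (ler_wpM2l _ (ler_norm_sum _ _ _)) _; first by rewrite exprn_ge0.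
  rewrite mulr_sumr; apply: ler_sum => -[k1 k2] /eqP /= mE.
  have -> : (r / 2) ^+ mdeg m = (r / 2) ^+ mdeg k1 * (r / 2) ^+ mdeg k2.
    by rewrite [in LHS]mE mdegD exprD.
  rewrite normrM.
  apply: le_trans (_ : (M * geo k1) * (M' * geo k2) <= _); last by rewrite mulrACA.
  rewrite (_ : _ * _ = (`|a k1| * (r / 2) ^+ mdeg k1) * (`|b k2| * (r / 2) ^+ mdeg k2)); last by ring.
  by apply: ler_pM; rewrite ?h // mulr_ge0 // exprn_ge0.
rewrite -mulr_sumr ler_wpM2l ?mulr_ge0 //.
have := @geo_pairs [seq (val k.1, val k.2) | k : bmultinom n (mdeg m).+1 * bmultinom n (mdeg m).+1 <- index_enum _ & P k].
rewrite big_map big_filter; apply.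
rewrite map_inj_uniq ?filter_uniq ?index_enum_uniq // => -[k1 k2] [l1 l2] /= [].
by move=> /val_inj -> /val_inj ->.
Qed.

(** The product of two partial sums exceeds the partial sum of the product by the pairs
    of monomials of total degree at least [N]. *)
Lemma psumM_err M M' r a b x N : 0 < r -> bnd M r a -> bnd M' r b ->
    (forall i, `|x i| <= r / 4) ->
  `|psum N a x * psum N b x - psum N (a * b) x| <= M * M' * 4 ^+ n / 2 ^+ N.
Proof.
move=> r0 A B xr.
have M0 := bnd_ge0 (ltW r0) A; have M0' := bnd_ge0 (ltW r0) B.
pose t (k : bmultinom n N * bmultinom n N) : mpoly n K := (a k.1 * b k.2) *: mpolyX K (k.1 ++m k.2).
have E : trunc N a * trunc N b = \sum_k t k.
  rewrite /trunc mulr_suml; under eq_bigr do rewrite mulr_sumr.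
  rewrite pair_bigA; apply: eq_bigr => -[k1 k2] _ /=.
  by rewrite /t mpolyXD -scalerAl -scalerAr scalerA.
have E' : trunc N (a * b) = \sum_(k : bmultinom n N * bmultinom n N | (mdeg (k.1 ++m k.2) < N)%N) t k.
  apply/mpolyP => m; case: (ltnP (mdeg m) N) => mN.
    rewrite mcoeff_trunc // (pserM_truncE _ _ mN) E !raddf_sum /=.
    rewrite [RHS]big_mkcond; apply: eq_bigr => k _; case: ltnP => // kN.
    rewrite mcoeffZ mcoeffX; case: eqP => [km|]; last by rewrite mulr0.
    by move: mN; rewrite -km ltnNge kN.
  rewrite !raddf_sum !big1 // => k /= kN; rewrite mcoeffZ mcoeffX.
    by case: eqP => [km|]; rewrite ?mulr0 //; move: kN; rewrite km ltnNge mN.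
  by case: eqP => [km|]; rewrite ?mulr0 //; move: (bmdeg k); rewrite km ltnNge mN.
rewrite !psumE -mevalM -mevalB E E' (bigID (fun k : bmultinom n N * bmultinom n N => (mdeg (k.1 ++m k.2) < N)%N)) /=.
rewrite addrAC subrr add0r raddf_sum /=.
apply: le_trans (ler_norm_sum _ _ _) _.
apply: (@le_trans _ _ (\sum_(k : bmultinom n N * bmultinom n N) M * M' / 2 ^+ N * (geo k.1 * geo k.2))).
  rewrite [leRHS](bigID (fun k : bmultinom n N * bmultinom n N => (mdeg (k.1 ++m k.2) < N)%N)) /=.
  rewrite -[leLHS]add0r lerD //.
    by apply: sumr_ge0 => k _; rewrite !mulr_ge0 ?geo_ge0 ?invr_ge0 ?exprn_ge0 ?ler0n.
  apply: ler_sum => -[k1 k2] /= kN; rewrite /t mevalZ mevalX.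
  have -> : \prod_(i < n) x i ^+ (k1 ++m k2) i = ev x k1 * ev x k2.
    by rewrite -big_split; apply: eq_bigr => i _; rewrite mnmDE exprD.
  rewrite mulrACA normrM.
  apply: le_trans (ler_pM _ _ (term_le k1 r0 A xr) (term_le k2 r0 B xr)) _ => //.
  rewrite [leLHS](_ : _ = M * M' * geo (k1 ++m k2) * (geo k1 * geo k2)); last first.
    by rewrite geoD; ring.
  rewrite ler_wpM2r ?mulr_ge0 ?geo_ge0 // ler_wpM2l ?mulr_ge0 // geo_le //.
  by rewrite leqNgt.
rewrite -mulr_sumr mulrAC ler_wpM2r ?invr_ge0 ?exprn_ge0 ?ler0n //.
rewrite ler_wpM2l ?mulr_ge0 //.
have := @geo_pairs [seq (val k.1, val k.2) | k : bmultinom n N * bmultinom n N].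
rewrite big_map big_enum; apply.
rewrite map_inj_uniq ?enum_uniq // => -[k1 k2] [l1 l2] /= [].
by move=> /val_inj -> /val_inj ->.
Qed.

End Estimates.

(** * Convergent power series *)

(** The real and the complex numbers enter only through this property and the next one.
    They are phrased with geometric rates because all the limits below are reached at
    such rates. *)
Definition pow2_unbounded (K : numFieldType) := forall x : K, 0 <= x -> exists N, x <= 2 ^+ N.

Definition geometric_complete (K : numFieldType) := forall (u : nat -> K) (M : K),
  (forall N N', (N <= N')%N -> `|u N' - u N| <= M / 2 ^+ N) ->
  exists l, forall N, `|l - u N| <= M / 2 ^+ N.

From mathcomp Require Import finmap classical_sets topology normedtype derive summability.
Import numFieldNormedType.Exports.
Local Open Scope classical_set_scope.

#[local] Existing Instance totally_filter.

Section Convergence.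
Variables (K : numFieldType) (n : nat).
Local Notation ps := (pser K n).
Local Notation mon := (multinom n).
Implicit Types (m k : mon) (a b : ps) (M r : K) (h g : 'rV[K]_n -> K^o) (x : 'rV[K]_n).

Hypothesis archi : pow2_unbounded K.
Hypothesis complete : geometric_complete K.

Lemma pow2_gt0 N : 0 < 2 ^+ N :> K. Proof. by rewrite exprn_gt0 ?ltr0n. Qed.

Lemma pow2_ge1 N : 1 <= 2 ^+ N :> K.
Proof. by rewrite -natrX ler1n expn_gt0. Qed.

Lemma quarter_le r : 0 < r -> r / 4 <= r.
Proof. by move=> r0; rewrite ler_pdivrMr ?ltr0n // ler_peMr ?ler1n // ltW. Qed.

Lemma geometric_le (u v M : K) : 0 <= M -> (forall N, u <= v + M / 2 ^+ N) -> u <= v.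
Proof.
move=> M0 H; rewrite -subr_le0; set d := u - v.
have {}H N : d <= M / 2 ^+ N by rewrite /d lerBlDl.
have dR : d \is Num.real.
  have := H 0%N; rewrite expr0 divr1 => dM.
  by rewrite (ler_real dM) ger0_real.
have [//|d0] := real_leP dR (real0 _).
have [N] : exists N, M / d <= 2 ^+ N by apply: archi; rewrite divr_ge0 // ltW.
rewrite ler_pdivrMr // => MN.
have : d <= d / 2.
  apply: le_trans (H N.+1) _; rewrite exprSr invfM mulrA ler_wpM2r ?invr_ge0 ?ler0n //.
  by rewrite ler_pdivrMr ?pow2_gt0 // mulrC.
by rewrite ler_pdivlMr ?ltr0n // ger_pMr // (ler_nat _ 2 1).
Qed.

Lemma geometric_eps (M e : K) : 0 <= M -> 0 < e -> exists N, M / 2 ^+ N < e.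
Proof.
move=> M0 e0; have [N] : exists N, M / e <= 2 ^+ N by apply: archi; rewrite divr_ge0 // ltW.
rewrite ler_pdivrMr // => MN; exists N.+1; rewrite ltr_pdivrMr ?pow2_gt0 //.
apply: le_lt_trans MN _; rewrite mulrC exprSr ltr_pM2l // ltr_pMr ?pow2_gt0 //.
by rewrite ltr1n.
Qed.

(** Convergence at a geometric rate.  Every power series convergent near 0 converges in
    this sense ([power_series_conv]), and in this form the analysis consists of estimates
    on finite sums. *)
Definition conv_at M r h a := [/\ 0 < r, bnd M r a &
  forall x, (forall i, `|x 0 i| <= r) -> forall N, `|h x - psum N a (x 0)| <= M / 2 ^+ N].

Definition conv h a := exists M r, conv_at M r h a.

Lemma conv_at_ge0 M r h a : conv_at M r h a -> 0 <= M.
Proof. by case=> r0 B _; apply: bnd_ge0 B; apply: ltW. Qed.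

Lemma conv_atW M M' r r' h a : 0 < r' -> r' <= r -> M <= M' ->
  conv_at M r h a -> conv_at M' r' h a.
Proof.
move=> r0 rr MM [_ B H]; split=> //; first by apply: bndW B => //; apply: ltW.
move=> x xr N; apply: le_trans (H x _ N) _; first by move=> i; apply: le_trans (xr i) _.
by rewrite ler_wpM2r // invr_ge0 ltW ?pow2_gt0.
Qed.

Lemma common_radius r r' : 0 < r -> 0 < r' -> exists2 s, 0 < s & (s <= r) && (s <= r').
Proof.
move=> r0 r0'; have [le|/ltW le] := real_leP (gtr0_real r0) (gtr0_real r0').
  by exists r; rewrite ?lexx.
by exists r'; rewrite ?lexx ?le.
Qed.

Lemma conv_common h h' a a' : conv h a -> conv h' a' ->
  exists M r, conv_at M r h a /\ conv_at M r h' a'.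
Proof.
move=> [M [r H]] [M' [r' H']]; have [r0 _ _] := H; have [r0' _ _] := H'.
have [s s0 /andP[sr sr']] := common_radius r0 r0'.
exists (M + M'), s; split.
  by apply: conv_atW H; rewrite // lerDl (conv_at_ge0 H').
by apply: conv_atW H'; rewrite // lerDr (conv_at_ge0 H).
Qed.

Lemma convD h h' a a' : conv h a -> conv h' a' -> conv (h + h') (a + a').
Proof.
move=> H H'; have [M [r [[r0 B C] [_ B' C']]]] := conv_common H H'.
exists (M + M), r; split=> //; first by apply: bndD => //; apply: ltW.
move=> x xr N; rewrite psumD mulrDl.
by apply: le_trans (lerD (C x xr N) (C' x xr N)); rewrite opprD addrACA ler_normD.
Qed.

Lemma convZ c h a : conv h a -> conv (c *: h) (c *: a).
Proof.
move=> [M [r [r0 B C]]]; exists (`|c| * M), r; split=> //; first exact: bndZ.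
by move=> x xr N; rewrite psumZ -mulrBr normrM -mulrA ler_wpM2l ?C.
Qed.

Lemma conv_bnd a M r : 0 < r -> bnd M r a -> exists h, conv h a.
Proof.
move=> r0 B; pose P x l := (forall i, `|x 0 i| <= r / 4) ->
  forall N, `|l - psum N a (x 0)| <= M * 2 ^+ n / 2 ^+ N.
have /choice[h hP] x : exists l, P x l.
  have [xr|nxr] := pselect (forall i, `|x 0 i| <= r / 4); last by exists 0 => /nxr.
  have [|l lP] := @complete (fun N => psum N a (x 0)) (M * 2 ^+ n).
    by move=> N N' NN; apply: (psum_cauchy r0 B xr NN).
  by exists l.
have M0 := bnd_ge0 (ltW r0) B; have r40 : 0 < r / 4 by rewrite divr_gt0 ?ltr0n.
exists h, (M * 2 ^+ n), (r / 4); split=> //.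
by apply: bndW B; rewrite ?quarter_le ?(ltW r40) // ler_peMr ?pow2_ge1.
Qed.

Lemma conv_poly (p : mpoly n K) : conv (fun x => meval (fun i => x 0 i) p) (pser_poly p).
Proof.
pose M := \sum_(m <- msupp p) `|mcoeff m p|.
have B : bnd M 1 (pser_poly p).
  move=> m; rewrite expr1n mulr1 /pser_poly.
  have [mp|/memN_msupp_eq0 ->] := boolP (m \in msupp p); last by rewrite normr0 sumr_ge0.
  by rewrite /M (big_rem m) //= lerDl sumr_ge0.
have r40 : 0 < 1 / 4 :> K by rewrite divr_gt0 ?ltr0n.
have M0 := bnd_ge0 ler01 B.
exists (M * 2 ^+ n), (1 / 4); split=> //.
  by apply: bndW B; rewrite ?quarter_le ?(ltW r40) // ler_peMr ?pow2_ge1.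
move=> x xr N; pose N' := maxn N (mmeasure mdeg p).
have -> : meval (fun i => x 0 i) p = psum N' (pser_poly p) (x 0).
  rewrite psumE; congr (meval _ _); apply/mpolyP => m.
  have [mN|mN] := ltnP (mdeg m) N'; first by rewrite mcoeff_trunc.
  rewrite memN_msupp_eq0 ?raddf_sum ?big1 //=.
    move=> k _; rewrite mcoeffZ mcoeffX; case: eqP => [km|]; last by rewrite mulr0.
    by move: mN; rewrite -km leqNgt bmdeg.
  by apply: contraL mN => /msize_mdeg_lt H; rewrite -ltnNge (leq_trans H) // leq_maxr.
by apply: (psum_cauchy ltr01 B xr); rewrite leq_maxl.
Qed.

Lemma convM h h' a a' : conv h a -> conv h' a' -> conv (fun x => h x * h' x) (a * a').
Proof.
move=> H H'; have [M [r [Ha Hb]]] := conv_common H H'.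
have M0 := conv_at_ge0 Ha; have [r0 B C] := Ha; have [_ B' C'] := Hb.
have r40 : 0 < r / 4 by rewrite divr_gt0 ?ltr0n.
have rr := quarter_le r0.
exists (M * M * (3 + 4 ^+ n)), (r / 4); split=> //.
  apply: bndW (bndM r0 B B'); first exact: ltW.
    by rewrite ler_pM2l // lef_pV2 ?posrE ?ltr0n // ler_nat.
  by rewrite ler_wpM2l ?mulr_ge0 // lerDr ler0n.
move=> x xr4 N; have xr i : `|x 0 i| <= r by apply: le_trans (xr4 i) rr.
pose A := psum N a (x 0); pose A' := psum N a' (x 0).
have hM g c : conv_at M r g c -> `|g x| <= M.
  by move=> [_ _ /(_ x xr 0%N)]; rewrite psum_bmons big_seq big1 ?subr0 ?expr0 ?divr1 // => m; rewrite mem_bmons.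
(* Each of the three error terms in [h] and [h'] is at most [M * M / 2 ^+ N]. *)
have -> : h x * h' x - psum N (a * a') (x 0) =
    h x * (h' x - A') + (h x - A) * h' x - (h x - A) * (h' x - A') + (A * A' - psum N (a * a') (x 0)).
  by ring.
have -> : M * M * (3 + 4 ^+ n) / 2 ^+ N = M * M * 3 / 2 ^+ N + M * M * 4 ^+ n / 2 ^+ N.
  by ring.
apply: le_trans (ler_normD _ _) _; rewrite lerD //; last first.
  exact: (psumM_err _ r0 B B').
have c1 := C x xr N; have c2 := C' x xr N.
have M2 : M / 2 ^+ N <= M by rewrite ler_pdivrMr ?pow2_gt0 // ler_peMr ?pow2_ge1.
have -> : M * M * 3 / 2 ^+ N = M * (M / 2 ^+ N) + (M / 2 ^+ N) * M + (M / 2 ^+ N) * M by ring.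
apply: le_trans (ler_normB _ _) _; rewrite lerD //; last first.
  by rewrite normrM ler_pM // (le_trans c2).
apply: le_trans (ler_normD _ _) _; rewrite lerD // normrM ler_pM ?(hM _ _ Ha) ?(hM _ _ Hb) //.
Qed.

(** The factor [rho ^+ 2] avoids the exponent [k - 2], which would be truncated. *)
Lemma pow_taylor (x t rho : K) (k : nat) : `|x| <= rho -> `|x + t| <= rho ->
  rho ^+ 2 * `|(x + t) ^+ k - x ^+ k - k%:R * t * x ^+ k.-1| <= `|t| ^+ 2 * (k ^ 2)%:R * rho ^+ k.
Proof.
move=> xr xtr; have r0 : 0 <= rho := le_trans (normr_ge0 _) xr.
elim: k => [|k IH]; first by rewrite !expr0 subrr !mul0r subr0 normr0 exp0n // !(mulr0, mul0r).
have -> : (x + t) ^+ k.+1 - x ^+ k.+1 - k.+1%:R * t * x ^+ k.+1.-1 =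
    (x + t) * ((x + t) ^+ k - x ^+ k - k%:R * t * x ^+ k.-1) + k%:R * t ^+ 2 * x ^+ k.-1.
  case: k {IH} => [|k] /=; first by rewrite !expr0 !expr1; ring.
  by rewrite !exprS -[k.+2%:R]natr1; ring.
have -> : `|t| ^+ 2 * (k.+1 ^ 2)%:R * rho ^+ k.+1 =
   rho * (`|t| ^+ 2 * (k ^ 2)%:R * rho ^+ k) + `|t| ^+ 2 * (k.*2.+1)%:R * rho ^+ k.+1.
  have -> : (k.+1 ^ 2 = k ^ 2 + k.*2.+1)%N by lia.
  by rewrite natrD [rho ^+ _]exprS; move: (k ^ 2)%:R (k.*2.+1)%:R => c d; ring.
apply: le_trans (ler_wpM2l _ (ler_normD _ _)) _; first by rewrite exprn_ge0.
rewrite mulrDr lerD //.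
  rewrite normrM mulrCA; apply: ler_pM => //; by rewrite mulr_ge0 // exprn_ge0.
rewrite !normrM normr_nat !normrX.
case: k {IH} => [|k]; first by rewrite !mul0r mulr0 !mulr_ge0 ?exprn_ge0 ?ler0n.
rewrite /= (_ : rho ^+ 2 * _ = `|t| ^+ 2 * k.+1%:R * (rho ^+ 2 * `|x| ^+ k)); last by ring.
apply: ler_pM; rewrite ?mulr_ge0 ?exprn_ge0 ?ler0n //.
  by rewrite ler_wpM2l ?exprn_ge0 // ler_nat; lia.
by rewrite -[k.+2]add2n exprD ler_wpM2l ?exprn_ge0 // lerXn2r ?nnegrE.
Qed.

(** The value at [x] of the [i]-th derivative of the monomial [m]. *)
Definition dev (x : 'I_n -> K) i m : K :=
  (m i)%:R * x i ^+ (m i).-1 * \prod_(j < n | j != i) x j ^+ m j.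

Lemma ev_dev (x : 'I_n -> K) i m : dev x i m = meval x (mderiv i (mpolyX K m)).
Proof.
rewrite mderivX mevalZ mevalX /dev -mulrA; congr (_ * _).
rewrite [RHS](bigD1 i) //= mnmBE mnm1E eqxx subn1; congr (_ * _).
by apply: eq_bigr => j ji; rewrite mnmBE mnm1E eq_sym (negbTE ji) subn0.
Qed.

Lemma psum_pD N i a (x : 'I_n -> K) :
  psum N (pD i a) x = \sum_(m : bmultinom n N.+1) a m * dev x i m.
Proof.
have E : trunc N (pD i a) = mderiv i (trunc N.+1 a).
  apply/mpolyP => m; rewrite mcoeff_mderiv.
  have out d (c : ps) k : (d <= mdeg k)%N -> mcoeff k (trunc d c) = 0.
    move=> dk; rewrite raddf_sum big1 //= => l _; rewrite mcoeffZ mcoeffX.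
    by case: eqP => [lk|]; rewrite ?mulr0 //; move: (bmdeg l); rewrite lk ltnNge dk.
  have dm : mdeg (m ++m mnm1 i) = (mdeg m).+1 by rewrite mdegD mdeg1 addn1.
  have [mN|mN] := ltnP (mdeg m) N; first by rewrite !mcoeff_trunc ?dm.
  by rewrite !out ?dm ?mul0rn.
rewrite psumE E /trunc [mderiv i _](linear_sum (mderiv i)) [LHS]raddf_sum; apply: eq_bigr => m _ /=.
by rewrite mderivZ mevalZ ev_dev.
Qed.

Definition bump_coord (x : 'I_n -> K) i (t : K) : 'I_n -> K :=
  fun j => if j == i then x i + t else x j.

Lemma ev_taylor (x : 'I_n -> K) i t (rho : K) m :
    (forall j, `|x j| <= rho) -> `|x i + t| <= rho ->
  rho ^+ 2 * `|ev (bump_coord x i t) m - ev x m - t * dev x i m| <=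
    `|t| ^+ 2 * (m i ^ 2)%:R * rho ^+ mdeg m.
Proof.
move=> xr xtr; have r0 : 0 <= rho := le_trans (normr_ge0 _) (xr i).
set P := \prod_(j < n | j != i) x j ^+ m j.
have -> : ev (bump_coord x i t) m - ev x m - t * dev x i m =
    ((x i + t) ^+ m i - x i ^+ m i - (m i)%:R * t * x i ^+ (m i).-1) * P.
  rewrite /ev (bigD1 i) //= [X in _ - X - _](bigD1 i) //= -/P /bump_coord eqxx.
  rewrite (eq_bigr (fun j => x j ^+ m j)) => [|j /negbTE -> //]; rewrite -/P /dev -/P.
  by ring.
have PE : `|P| <= rho ^+ (mdeg m - m i).
  rewrite mdegE (bigD1 i) //= addnC addnK expr_sum normr_prod.
  by apply: ler_prod => j _; rewrite normr_ge0 normrX lerXn2r ?nnegrE.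
have -> : rho ^+ mdeg m = rho ^+ m i * rho ^+ (mdeg m - m i).
  by rewrite -exprD subnKC // mdegE (bigD1 i) //= leq_addr.
rewrite normrM !mulrA; apply: ler_pM => //; first by rewrite mulr_ge0 // exprn_ge0.
exact: pow_taylor.
Qed.

(** Uniformity in [N] lets the estimate pass to the limit.  Shrinking the radius by 8
    gives a factor [8 ^- mdeg m], of which [4 ^- mdeg m] absorbs the squared exponent and
    the rest is summable. *)
Lemma psum_taylor M r a (x : 'I_n -> K) i t (rho : K) N : 0 < r -> bnd M r a ->
    0 < rho -> rho <= r / 8 -> (forall j, `|x j| <= rho) -> `|x i + t| <= rho ->
  `|psum N.+1 a (bump_coord x i t) - psum N.+1 a x - t * psum N (pD i a) x| <=
    M * 2 ^+ n / rho ^+ 2 * `|t| ^+ 2.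
Proof.
move=> r0 B rho0 rr xr xtr; have M0 := bnd_ge0 (ltW r0) B.
rewrite psum_pD /psum mulr_sumr -!sumrB; apply: le_trans (ler_norm_sum _ _ _) _.
apply: (@le_trans _ _ (\sum_(m : bmultinom n N.+1) M / rho ^+ 2 * `|t| ^+ 2 * geo K m)).
  apply: ler_sum => m _; set e := ev _ _.
  have -> : a m * e - a m * ev x m - t * (a m * dev x i m) = a m * (e - ev x m - t * dev x i m).
    by ring.
  rewrite normrM -(ler_pM2l (exprn_gt0 2 rho0)) mulrCA.
  apply: le_trans (ler_wpM2l _ (ev_taylor m xr xtr)) _ => //.
  rewrite (_ : _ * (M / _ * _ * _) = `|t| ^+ 2 * (M * geo K m)); last by field; rewrite gt_eqF.
  rewrite [leLHS](_ : _ = `|t| ^+ 2 * (`|a m| * ((m i ^ 2)%:R * rho ^+ mdeg m))); last by ring.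
  rewrite ler_wpM2l ?exprn_ge0 //.
  have h1 : (m i ^ 2)%:R * rho ^+ mdeg m <= r ^+ mdeg m * geo K m.
    apply: (@le_trans _ _ (4 ^+ mdeg m * (r / 8) ^+ mdeg m)).
      apply: ler_pM; rewrite ?ler0n ?exprn_ge0 ?(ltW rho0) //.
        rewrite -natrX ler_nat (_ : 4 = 2 ^ 2)%N // -expnM mulnC expnM leq_sqr.
        apply: leq_trans (ltnW (ltn_expl (m i) (ltnSn 1))) _.
        by rewrite leq_exp2l // mdegE (bigD1 i) //= leq_addr.
      by rewrite lerXn2r ?nnegrE ?(ltW rho0) // divr_ge0 ?ler0n // ltW.
    by rewrite /geo -!exprMn (_ : 4 * (r / 8) = r * 2^-1) //; field.
  apply: le_trans (ler_wpM2l _ h1) _ => //.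
  by rewrite mulrA ler_wpM2r ?geo_ge0 ?B.
rewrite -mulr_sumr (_ : M * _ / _ * _ = M / rho ^+ 2 * `|t| ^+ 2 * 2 ^+ n); last by ring.
rewrite ler_wpM2l ?mulr_ge0 ?invr_ge0 ?exprn_ge0 ?normr_ge0 ?(ltW rho0) //.
by have := geo_sum K (bmons_uniq n N.+1); rewrite /bmons big_map big_enum.
Qed.

Lemma bnd_pD M r i a : 0 < r -> bnd M r a -> bnd (M / r) (r / 2) (pD i a).
Proof.
move=> r0 B m; rewrite pDE -[X in `|X|]mulr_natl normrM normr_nat.
rewrite ler_pdivlMr // exprMn.
have mi : (m i).+1%:R * 2^-1 ^+ mdeg m <= 1 :> K.
  rewrite exprVn ler_pdivrMr ?pow2_gt0 // mul1r -natrX ler_nat.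
  apply: leq_trans (ltn_expl _ (ltnSn 1)) _.
  by rewrite leq_exp2l // mdegE (bigD1 i) //= leq_addr.
have := B (m ++m mnm1 i); rewrite mdegD mdeg1 exprD expr1 => Bm.
rewrite (_ : _ * _ = (m i).+1%:R * 2^-1 ^+ mdeg m * (`|a (m ++m mnm1 i)| * (r ^+ mdeg m * r))).
  by rewrite -[leRHS]mul1r ler_pM ?mulr_ge0 ?ler0n ?exprn_ge0 ?invr_ge0 ?ler0n // ltW.
by ring.
Qed.

Lemma conv_growth h h' i a : conv h a -> conv h' (pD i a) ->
  exists C rho, [/\ 0 <= C, 0 < rho & forall x t, (forall j, `|x 0 j| <= rho) -> `|x 0 i + t| <= rho ->
    `|h (t *: delta_mx 0 i + x) - h x - t * h' x| <= C * `|t| ^+ 2].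
Proof.
move=> [M [r H]] [M' [r' H']].
have [r0 B Ha] := H; have [r0' B' Ha'] := H'.
have M0 := conv_at_ge0 H; have M0' := conv_at_ge0 H'.
have r80 : 0 < r / 8 by rewrite divr_gt0 ?ltr0n.
have [rho rho0 /andP[rr rr']] := common_radius r80 r0'.
have r8 : r / 8 <= r by rewrite ler_pdivrMr ?ltr0n // ler_peMr ?ler1n // ltW.
exists (M * 2 ^+ n / rho ^+ 2), rho; split=> //.
  by rewrite !mulr_ge0 ?invr_ge0 ?exprn_ge0 ?ler0n ?(ltW rho0).
move=> x t xr xtr.
set y := _ *: _ + _; have yE j : y 0 j = bump_coord (x 0) i t j.
  rewrite /y !mxE eqxx /bump_coord; case: eqP => [->|_]; rewrite ?mulr1 ?mulr0 ?add0r //.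
  by rewrite addrC.
have yr j : `|y 0 j| <= rho by rewrite yE /bump_coord; case: eqP.
apply: (geometric_le (M := 2 * M + `|t| * M')) => [|N]; first by rewrite addr_ge0 ?mulr_ge0 ?ler0n.
have e1 := Ha y (fun j => le_trans (yr j) (le_trans rr r8)) N.+1.
have e2 := Ha x (fun j => le_trans (xr j) (le_trans rr r8)) N.+1.
have e3 := Ha' x (fun j => le_trans (xr j) rr') N.
have e4 := psum_taylor N r0 B rho0 rr xr xtr.
have pE : psum N.+1 a (y 0) = psum N.+1 a (bump_coord (x 0) i t).
  by congr (psum _ _ _); apply/funext.
rewrite pE in e1.
have MN : M / 2 ^+ N.+1 <= M / 2 ^+ N.
  by rewrite ler_wpM2l // lef_pV2 ?posrE ?pow2_gt0 // ler_weXn2l ?ler1n.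
set u := psum N.+1 a (bump_coord _ _ _) in e1 e4; set v := psum N.+1 a (x 0) in e2 e4.
set w := psum N _ _ in e3 e4.
have -> : h y - h x - t * h' x = (u - v - t * w) + ((h y - u) - (h x - v) - t * (h' x - w)) by ring.
apply: le_trans (ler_normD _ _) _; rewrite lerD //.
apply: le_trans (ler_normB _ _) _; rewrite mulrDl lerD //.
  apply: le_trans (ler_normB _ _) _; rewrite mulr_natl mulr2n mulrDl.
  by rewrite lerD // ?(le_trans e1) ?(le_trans e2).
by rewrite normrM -mulrA ler_wpM2l.
Qed.

Lemma near0_coords (P : 'rV[K]_n -> Prop) : (\forall x \near (0 : 'rV[K]_n), P x) <->
  exists2 e : K, 0 < e & forall x, (forall i, `|x 0 i| <= e) -> P x.
Proof.
split=> [/nbhs_ballP[e e0 H]|[e e0 H]].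
  exists (e / 2) => [|x xe]; first by rewrite divr_gt0 ?ltr0n.
  apply: H; split=> // i j; rewrite mxE (ord1 i) -ball_normE /ball_ /= sub0r normrN.
  by apply: le_lt_trans (xe j) _; rewrite ltr_pdivrMr ?ltr0n // ltr_pMr // ltr1n.
apply/nbhs_ballP; exists e => // x [_ xe]; apply: H => i.
by have := xe 0 i; rewrite mxE -ball_normE /ball_ /= sub0r normrN => /ltW.
Qed.

(** The derived series has a sum by completeness; the uniform quadratic remainder
    identifies it with the derivative of the sum. *)
Lemma conv_derive h i a : conv h a -> conv ('D_(delta_mx 0 i) h) (pD i a).
Proof.
move=> H; have [M [r [r0 B _]]] := H.
have [|h' H'] := @conv_bnd (pD i a) (M / r) (r / 2) _ (bnd_pD i r0 B).
  by rewrite divr_gt0 ?ltr0n.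
have [C [rho [C0 rho0 E]]] := conv_growth H H'.
have rho20 : 0 < rho / 2 by rewrite divr_gt0 ?ltr0n.
have rhoE : rho / 2 + rho / 2 = rho by field.
have DE x : (forall j, `|x 0 j| <= rho / 2) -> 'D_(delta_mx 0 i) h x = h' x.
  move=> xr; apply: cvg_lim; first exact: norm_hausdorff.
  apply/cvgrPdist_lt => e e0.
  have C1 : 0 < C + 1 by rewrite ltr_wpDl.
  near=> t.
  have t0 : t != 0 by near: t; apply: nbhs_dnbhs_neq.
  have tr : `|t| < rho / 2 by near: t; apply: dnbhs0_lt.
  have te : `|t| < e / (C + 1) by near: t; apply: dnbhs0_lt; rewrite divr_gt0.
  have xr' j : `|x 0 j| <= rho by apply: le_trans (xr j) _; rewrite -{2}rhoE lerDl ltW.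
  have xtr : `|x 0 i + t| <= rho.
    by apply: le_trans (ler_normD _ _) _; rewrite -rhoE lerD // ltW.
  have := E x t xr' xtr; rewrite /= => Et.
  have -> : h' x - t^-1 *: (h (t *: delta_mx 0 i + x) - h x) =
      - t^-1 * (h (t *: delta_mx 0 i + x) - h x - t * h' x).
    by rewrite /GRing.scale /=; field.
  rewrite normrM normrN normfV mulrC ltr_pdivrMr ?normr_gt0 //.
  apply: le_lt_trans Et _; rewrite expr2 mulrA ltr_pM2r ?normr_gt0 //.
  apply: (@le_lt_trans _ _ ((C + 1) * `|t|)); first by rewrite ler_wpM2r ?lerDl.
  by rewrite mulrC -ltr_pdivlMr.
have [M' [r' G]] := H'; have [r0' _ _] := G.
have [s s0 /andP[sr sr']] := common_radius rho20 r0'.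
have [_ B' G'] := conv_atW s0 sr' (lexx _) G.
rewrite /conv; exists M'; exists s; split=> // x xs N; rewrite DE ?G' // => j.
exact: le_trans (xs j) sr.
Unshelve. all: by end_near.
Qed.

Lemma psum_at0 N a : psum N.+1 a (fun=> 0) = a mnm0.
Proof.
rewrite psum_bmons (bigD1_seq mnm0) ?bmons_uniq ?mem_bmons ?mdeg0 //=.
rewrite big1 => [|m m0].
  by rewrite addr0 /ev big1 ?mulr1 // => i _; rewrite mnm0E.
have [i mi] := mnm_neq0 m0.
by rewrite /ev (bigD1 i) //= expr0n (negbTE mi) mul0r mulr0.
Qed.

(** Identity theorem: up to a nonzero integer, every coefficient is the constant term of
    an iterated derivative, and the derivatives of a function vanishing near 0 vanish
    near 0. *)
Lemma conv_near0 h a : conv h a -> (\forall x \near (0 : 'rV[K]_n), h x = 0) -> a = 0.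
Proof.
move=> H h0; apply/funext => m; rewrite pser0.
have [d] := ubnP (mdeg m); elim: d h a H h0 m => // d IH h a H h0 m md.
have [->|m0] := eqVneq m mnm0.
  have [M [r G]] := H; have M0 := conv_at_ge0 G; have [r0 _ C] := G.
  apply/eqP; rewrite -normr_le0; apply: (geometric_le M0) => N.
  have z i : `|(0 : 'rV[K]_n) 0 i| <= r by rewrite mxE normr0 ltW.
  have := C 0 z N.+1; rewrite (nbhs_singleton h0) sub0r normrN.
  have -> : (0 : 'rV[K]_n) 0 = (fun=> 0) by apply/funext => i; rewrite mxE.
  rewrite psum_at0 add0r => le; apply: le_trans le _.
  by rewrite ler_wpM2l // lef_pV2 ?posrE ?pow2_gt0 // ler_weXn2l ?ler1n.
have [i mi] := mnm_neq0 m0.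
have mE : m = mnm_sub m (mnm1 i) ++m mnm1 i by rewrite submK // lep1mP.
have : pD i a (mnm_sub m (mnm1 i)) = 0.
  apply: (IH _ _ (conv_derive i H)).
    have /nbhs_interior := h0; apply: filterS => x /(@near_eq_derive _ _ _ h (cst 0) x) ->.
    exact: derive_cst.
  by move: md; rewrite {1}mE mdegD mdeg1 addn1.
by rewrite pDE -mE -mulr_natl => /eqP; rewrite mulf_eq0 pnatr_eq0 /= => /eqP.
Qed.

Lemma conv_eqP h h' a a' : conv h a -> conv h' a' ->
  (\forall x \near (0 : 'rV[K]_n), h x = h' x) <-> a = a'.
Proof.
move=> H H'; split=> [E|E].
  have := convD H (convZ (-1) H'); rewrite !scaleN1r => /conv_near0 D.
  apply/eqP; rewrite -subr_eq0; apply/eqP/D.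
  by apply: filterS E => x Ex; rewrite !fctE Ex subrr.
have [M [r [G G']]] := conv_common H H'; have [r0 _ C] := G; have [_ _ C'] := G'.
have M0 := conv_at_ge0 G; subst a'.
apply/near0_coords; exists r => // x xr; apply/eqP; rewrite -subr_eq0 -normr_le0.
apply: (geometric_le (M := M + M)) => [|N]; first exact: addr_ge0.
rewrite add0r mulrDl.
rewrite (_ : h x - h' x = (h x - psum N a (x 0)) - (h' x - psum N a (x 0))); last by ring.
by apply: le_trans (ler_normB _ _) _; rewrite lerD ?C ?C'.
Qed.

Definition power_series_at h a := \forall x \near (0 : 'rV[K]_n),
  partial_sum (power_term a x) @ totally --> (h x : K).

Lemma partial_sum_seq a x (A : {fset mon}) :
  partial_sum (power_term a x) A = \sum_(m <- A) a m * ev (x 0) m.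
Proof. by rewrite /partial_sum (big_seq_fsetE _ A xpredT (fun m => a m * ev (x 0) m)). Qed.

Definition bfset N : {fset mon} := [fset m in bmons n N]%fset.

Lemma bfset_sub N (A : {fset mon}) : (bfset N `<=` A)%fset -> {subset bmons n N <= A}.
Proof. by move=> /fsubsetP s m mN; apply: s; rewrite inE. Qed.

Lemma conv_power_series h a : conv h a -> power_series_at h a.
Proof.
move=> [M [r G]]; have M0 := conv_at_ge0 G; have [r0 B C] := G.
have r40 : 0 < r / 4 by rewrite divr_gt0 ?ltr0n.
apply/near0_coords; exists (r / 4) => // x xr.
apply/cvgrPdist_lt => e e0.
have M1 : 0 <= M + M * 2 ^+ n by rewrite addr_ge0 // mulr_ge0 // exprn_ge0 ?ler0n.
have [N Ne] := geometric_eps M1 e0.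
exists (bfset N) => //= A /bfset_sub NA.
apply: le_lt_trans Ne; rewrite partial_sum_seq mulrDl.
have := psum_tail r0 B xr (fset_uniq A) NA.
have := C x (fun i => le_trans (xr i) (quarter_le r0)) N.
set s := \sum_(_ <- _) _; set p := psum _ _ _ => h1 h2.
rewrite (_ : h x - s = (h x - p) - (s - p)); last by ring.
by apply: le_trans (ler_normB _ _) _; rewrite lerD.
Qed.

(** The terms of an unordered convergent sum are bounded, so evaluating at a point
    of the diagonal bounds the coefficients geometrically. *)
Lemma power_series_conv h a : power_series_at h a -> conv h a.
Proof.
move=> /near0_coords[e e0 H].
pose x0 : 'rV[K]_n := \row_i e.
have x0e i : `|x0 0 i| <= e by rewrite mxE gtr0_norm.
have /cvgrPdist_lt/(_ 1 ltr01)[A0 _ A0P] := H x0 x0e.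
pose M := 2 + \sum_(m <- A0) `|a m * ev (x0 0) m|.
have evE m : ev (x0 0) m = e ^+ mdeg m.
  by rewrite /ev mdegE expr_sum; apply: eq_bigr => i _; rewrite mxE.
have B : bnd M e a.
  move=> m; have -> : `|a m| * e ^+ mdeg m = `|a m * ev (x0 0) m|.
    by rewrite normrM evE (ger0_norm (exprn_ge0 _ (ltW e0))).
  have [mA|mA] := boolP (m \in A0).
    rewrite /M (big_rem m) //= addrCA lerDl addr_ge0 ?ler0n //.
    by apply: sumr_ge0.
  have h1 := A0P A0 (fsubset_refl _); have h2 := A0P (m |` A0)%fset (fsubsetU1 _ _).
  move: h1 h2; rewrite /= !partial_sum_seq big_fsetU1 //=.
  set s := \sum_(_ <- _) _; set t := _ * _ => h1 h2.
  apply: (@le_trans _ _ 2); last by rewrite lerDl sumr_ge0.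
  rewrite (_ : t = (h x0 - s) - (h x0 - (t + s))); last by ring.
  by apply: le_trans (ler_normB _ _) _; rewrite -[2]/(1 + 1) lerD // ltW.
have e40 : 0 < e / 4 by rewrite divr_gt0 ?ltr0n.
have M0 := bnd_ge0 (ltW e0) B.
exists (M * 2 ^+ n), (e / 4); split=> //.
  by apply: bndW B; rewrite ?quarter_le ?(ltW e40) // ler_peMr ?pow2_ge1.
move=> x xe N; apply: (geometric_le ler01) => k.
have k0 : 0 < 1 / 2 ^+ k :> K by rewrite divr_gt0 ?pow2_gt0.
have /cvgrPdist_lt/(_ _ k0)[A _ AP] := H x (fun i => le_trans (xe i) (quarter_le e0)).
have {AP} := AP (A `|` bfset N)%fset (fsubsetUl _ _).
rewrite /= partial_sum_seq => h1.
have := psum_tail e0 B xe (fset_uniq (A `|` bfset N)%fset) (bfset_sub (fsubsetUr _ _)).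
set s := \sum_(_ <- _) _ in h1 *; set p := psum _ _ _ => h2.
rewrite (_ : h x - p = (s - p) + (h x - s)); last by ring.
by apply: le_trans (ler_normD _ _) _; rewrite lerD // ltW.
Qed.

(** The recursion of [pser_polyM_lead] lowers the weight by at least 1.  Measured with
    the powers [tau ^+ wt l m], each step therefore gains a factor [tau], and the
    recursion is contracting for [tau] small. *)
Lemma bnd_div (p : mpoly n K) (q : ps) M r : p != 0 -> 0 < r ->
  bnd M r (pser_poly p * q) -> exists M' r', 0 < r' /\ bnd M' r' q.
Proof.
move=> /lead_monomial[l [m0 [l0 pm0 lmin]]] r0 B; have M0 := bnd_ge0 (ltW r0) B.
pose A : K := `|mcoeff m0 p|; have A0 : 0 < A by rewrite normr_gt0.
pose S : K := \sum_(k <- msupp p | k != m0) `|mcoeff k p|.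
have S0 : 0 <= S by apply: sumr_ge0.
have [t1 t10 /andP[t1r t11]] := common_radius r0 (@ltr01 K).
have A20 : 0 < A / 2 / (S + 1) by rewrite !divr_gt0 ?ltr0n // ltr_wpDl.
have [tau tau0 /andP[tt1 tauA]] := common_radius t10 A20.
have taur := le_trans tt1 t1r; have tau1 := le_trans tt1 t11.
have tauS : tau * S <= A / 2.
  apply: le_trans (_ : tau * (S + 1) <= _); first by rewrite ler_wpM2l ?(ltW tau0) ?lerDl.
  by rewrite -ler_pdivlMr // ltr_wpDl.
have degwt m : (mdeg m <= wt l m)%N.
  by rewrite mdegE leq_sum // => i _; rewrite leq_pmull.
have powle (j k : nat) : (j <= k)%N -> tau ^+ k <= tau ^+ j.
  by move=> jk; rewrite ler_wiXn2l // ltW.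
have tauX_gt0 (k : nat) : 0 < tau ^+ k by rewrite exprn_gt0.
have B' m : `|(pser_poly p * q) m| * tau ^+ wt l m <= M.
  apply: le_trans (B m); rewrite ler_wpM2l //; apply: le_trans (powle _ _ (degwt m)) _.
  by rewrite lerXn2r // nnegrE ltW.
(* [C] is the fixed point of the affine recursion with ratio 1/2. *)
pose C := 2 * M / tau ^+ wt l m0 / A.
have C0 : 0 <= C by rewrite /C !divr_ge0 ?mulr_ge0 ?ler0n ?(ltW A0) ?(ltW (tauX_gt0 _)).
have H m : `|q m| * tau ^+ wt l m <= C.
  have [d] := ubnP (wt l m); elim: d m => // d IH m md.
  rewrite -(ler_pM2l A0) mulrA -normrM.
  have -> : mcoeff m0 p * q m = (pser_poly p * q) (m0 ++m m) - \sum_(k <- msupp p | k != m0)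
     mcoeff k p * (if lem k (m0 ++m m) then q (mnm_sub (m0 ++m m) k) else 0).
    by rewrite pser_polyM_lead // addrK.
  apply: le_trans (ler_wpM2r _ (ler_normB _ _)) _; first exact: ltW.
  rewrite mulrDl (_ : A * C = M / tau ^+ wt l m0 + C * (A / 2)); last first.
    by rewrite /C; field; rewrite !gt_eqF.
  apply: lerD.
    by rewrite ler_pdivlMr // -mulrA -exprD addnC -wtD.
  apply: (@le_trans _ _ (C * (tau * S))); last by rewrite ler_wpM2l.
  apply: le_trans (ler_wpM2r _ (ler_norm_sum _ _ _)) _; first exact: ltW.
  rewrite mulr_suml mulrA mulr_sumr big_seq_cond [leRHS]big_seq_cond.
  apply: ler_sum => k /andP[kp km]; rewrite normrM [leRHS]mulrC -mulrA ler_wpM2l //.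
  case: ifP => [km0|_]; last by rewrite normr0 mul0r mulr_ge0 // ltW.
  have := wt_lead_drop km0 (lmin _ kp km); have kl := lmin _ kp km.
  set m' := mnm_sub _ _; set e := (_ - _)%N => we.
  have e1 : (1 <= e)%N by rewrite subn_gt0.
  rewrite -we exprD mulrA ler_pM ?mulr_ge0 ?(ltW (tauX_gt0 _)) //.
    by apply: IH; move: md we e1; clear; move: (wt l m) (wt l m') e => u v e; lia.
  by rewrite -[leRHS]expr1 powle.
(* Back from the weight to the degree: [wt l m <= (\sum_i l i) * mdeg m]. *)
exists C, (tau ^+ \sum_i l i); split=> // m.
apply: le_trans (H m); rewrite ler_wpM2l // -exprM powle //.
rewrite /wt big_distrl /=; apply: leq_sum => i _.
by rewrite leq_mul2l mdegE (bigD1 i) //= leq_addr orbT.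
Qed.

(** Integration divides coefficients by positive integers. *)
Lemma bnd_integrate (b : ps) : (forall i, exists M r, 0 < r /\ bnd M r (pD i b)) ->
  exists M r, 0 < r /\ bnd M r b.
Proof.
move=> H; have {H} [M [r [M0 [r0 B]]]] : exists M r, 0 <= M /\ 0 < r /\ forall i, bnd M r (pD i b).
  suff [M [r [M0 [r0 B]]]] : exists M r, 0 <= M /\ 0 < r /\ forall i, i \in enum 'I_n -> bnd M r (pD i b).
    by exists M, r; split=> //; split=> // i; apply: B; rewrite mem_enum.
  elim: (enum _) => [|i s [M [r [M0 [r0 B]]]]]; first by exists 0, 1; rewrite lexx ltr01.
  have [M' [r' [r0' B']]] := H i; have M0' := bnd_ge0 (ltW r0') B'.
  have [t t0 /andP[tr tr']] := common_radius r0 r0'.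
  exists (M + M'), t; split; first exact: addr_ge0.
  split=> // j; rewrite inE => /orP[/eqP ->|/B Bj].
    by apply: bndW B'; rewrite ?(ltW t0) // lerDr.
  by apply: bndW Bj; rewrite ?(ltW t0) // lerDl.
exists (`|b mnm0| + M * r), r; split=> // m.
have [->|/mnm_neq0[i mi]] := eqVneq m mnm0.
  by rewrite mdeg0 expr0 mulr1 lerDl mulr_ge0 // ltW.
have mE : m = mnm_sub m (mnm1 i) ++m mnm1 i by rewrite submK // lep1mP.
apply: le_trans (_ : M * r <= _); last by rewrite lerDr.
rewrite {2}mE mdegD mdeg1 exprD expr1 mulrA ler_wpM2r ?(ltW r0) //.
apply: le_trans (B i (mnm_sub m (mnm1 i))); rewrite ler_wpM2r ?exprn_ge0 ?(ltW r0) //.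
by rewrite pDE -mE normrMn mulrS lerDl mulrn_wge0.
Qed.

Theorem taylor_analytic : taylor (F := analytic_germs K n) power_series_at.
Proof.
have P h a : power_series_at h a <-> conv h a.
  by split; [apply: power_series_conv|apply: conv_power_series].
split.
- by [].
- by move=> h h' a a' /P H /P H'; apply: conv_eqP.
- by move=> h h' a a' /P H /P H'; apply/P/convD.
- by move=> c h a /P H; apply/P/convZ.
- by move=> h h' a a' /P H /P H'; apply/P/convM.
- by move=> i h a /P H; apply/P/conv_derive.
- by move=> p; apply/P/conv_poly.
move=> p p0 b H.
have [i|M [r [r0 B]]] := @bnd_integrate b.
  have [h /P[M [r [r0 B _]]]] := H i.
  exact: bnd_div p0 r0 B.
by have [h ?] := conv_bnd r0 B; exists h; apply/P.
Qed.

End Convergence.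

(** * The ground fields *)


Section GroundFields.
Variable R : realType.

Lemma real_pow2_unbounded : pow2_unbounded R.
Proof.
move=> x x0; exists (Num.bound x); apply/ltW/(lt_le_trans (archi_boundP x0)).
by rewrite -natrX ler_nat ltnW // ltn_expl.
Qed.

(** The limit is the supremum of the lower ends of the nested intervals of centre [u N]
    and radius [M / 2 ^+ N]. *)
Lemma real_geometric_complete : geometric_complete R.
Proof.
move=> u M H; pose e N := M / 2 ^+ N.
have M0 : 0 <= M by have := H 0%N 0%N (leqnn _); rewrite subrr normr0 expr0 divr1.
have emono N N' : (N <= N')%N -> e N' <= e N.
  by move=> NN; rewrite ler_wpM2l // lef_pV2 ?posrE ?exprn_gt0 // ler_weXn2l ?ler1n.
have bd N N' : u N - e N <= u N' + e N'.
  have [NN|/ltnW NN] := leqP N N'; have := H _ _ NN; rewrite ler_distl => /andP[h1 h2].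
    by apply: le_trans h1 _; rewrite lerDl divr_ge0 // exprn_ge0.
  by rewrite lerBlDr; apply: le_trans h2 _; rewrite lerDl divr_ge0 // exprn_ge0.
pose E := [set y | exists N, y = u N - e N].
exists (sup E) => N; rewrite ler_distl; apply/andP; split.
  by apply: ub_le_sup; [exists (u 0%N + e 0%N) => _ [N' ->]|exists N].
by apply: ge_sup; [exists (u 0%N - e 0%N), 0%N|move=> _ [N' ->]].
Qed.

Local Notation C := (complex R).

Lemma complex_pow2_unbounded : pow2_unbounded C.
Proof.
move=> x x0; have xE : x = real_complex R (complex.Re x) by rewrite RRe_real // ger0_real.
have [|N Nx] := real_pow2_unbounded (x := complex.Re x); first by rewrite -lecR -xE.
by exists N; rewrite xE -(rmorph_nat (real_complex R) 2) -rmorphXn lecR.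
Qed.

Lemma norm_real_complex (x : R) : `|real_complex R x| = real_complex R `|x| :> C.
Proof. by rewrite normc_def /= expr0n addr0 sqrtr_sqr. Qed.

Lemma norm_imaginary_unit : `|Complex 0 1 : C| = 1.
Proof. by rewrite normc_def /= expr0n add0r expr1n sqrtr1. Qed.

(** Taking real and imaginary parts loses a factor 2 in the rate, recovered by comparing
    with terms of arbitrarily high index. *)
Lemma complex_geometric_complete : geometric_complete C.
Proof.
move=> u M H; have M0 : 0 <= M.
  by have := H 0%N 0%N (leqnn _); rewrite subrr normr0 expr0 divr1.
have ME : M = real_complex R (complex.Re M) by rewrite RRe_real // ger0_real.
have MN N : M / 2 ^+ N = real_complex R (complex.Re M / 2 ^+ N).
  by rewrite [in LHS]ME rmorphM fmorphV rmorphXn rmorph_nat.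
have [|a aE] := @real_geometric_complete (fun N => complex.Re (u N)) (complex.Re M).
  move=> N N' NN; rewrite -lecR -MN; apply: le_trans (H _ _ NN).
  by rewrite -(raddfB (@complex.Re R : Rcomplex R -> R)); apply: normc_ge_Re.
have [|b bE] := @real_geometric_complete (fun N => complex.Im (u N)) (complex.Re M).
  move=> N N' NN; rewrite -lecR -MN; apply: le_trans (H _ _ NN).
  rewrite -(raddfB (@complex.Im R : Rcomplex R -> R)) -normrN -ReiNIm.
  apply: le_trans (normc_ge_Re _) _.
  by rewrite normrM norm_imaginary_unit mulr1.
pose l : C := Complex a b.
have lE N : `|l - u N| <= M / 2 ^+ N + M / 2 ^+ N.
  rewrite [l - u N]complexE; apply: le_trans (ler_normD _ _) _.
  rewrite normrM norm_imaginary_unit mul1r !norm_real_complex MN.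
  rewrite lerD // lecR.
    by rewrite (raddfB (@complex.Re R : Rcomplex R -> R)); apply: aE.
  by rewrite (raddfB (@complex.Im R : Rcomplex R -> R)); apply: bE.
exists l => N; apply: (geometric_le complex_pow2_unbounded (M := M + M)) => [|k].
  exact: addr_ge0.
have -> : l - u N = (u (N + k)%N - u N) + (l - u (N + k)%N) by ring.
apply: le_trans (ler_normD _ _) _; rewrite lerD ?H ?leq_addr //.
apply: le_trans (lE _) _; rewrite -mulrDl ler_wpM2l ?addr_ge0 //.
by rewrite lef_pV2 ?posrE ?exprn_gt0 ?ltr0n // ler_weXn2l ?ler1n // leq_addl.
Qed.

End GroundFields.

Theorem theorem3p11 (R : realType) (s : setting) (n : nat) (hn : (3 <= n)%N)
    (f : mpoly n (ground R s)) :
  let F := germs_at0 R s n in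
  let fg : F := germ_poly F f in
  quasihomogeneous f ->
  meval (fun _ => 0) f = 0 ->
  finite_codimension fg ->
  has_dim_mod (cocycle fg (k := 1%N)) (coboundary fg (k := 1%N)) 1 /\
  spans_mod (cocycle fg (k := 1%N)) (coboundary fg (k := 1%N))
    (fun _ : 'I_1 => dfun fg).
Proof.
case: s f => f F fg.
- exact: (H1_spanned_by_df (taylor_formal _ _)).
- exact: (H1_spanned_by_df (taylor_formal _ _)).
- exact: (H1_spanned_by_df (taylor_analytic n (@real_pow2_unbounded R) (@real_geometric_complete R))).
- exact: (H1_spanned_by_df (taylor_analytic n (@complex_pow2_unbounded R) (@complex_geometric_complete R))).
Qed.
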